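(* Let $X$ be a complex Banach space and suppose that $x=(x_n)_{n\ge 0} \in \ell^\infty(\mathbb{Z}_+;X)$ satisfies $$\sup_{n\ge0} \Big\|\sum_{k=0}^n x_k \Big\|< \infty.$$ Suppose further that the function $G_x$ admits a boundary function $F_x \in C^\infty(\mathbb{T}\setminus\{1\}; X)$. Let $m\colon (0,\pi] \to (0,\infty)$ be a continuous, non-increasing function and assume there exists $C > 0$ such that $$\|F_x^{(j)}(e^{i\theta})\| \leq C\, j!\, |\theta|\, m(|\theta|)^{j+1}, \qquad 0 < |\theta| \leq \pi,$$ for all integers $j\ge0$. Then, for every $c \in (0,1)$, $$\|x_n\| = O\big(m_{\log}^{-1}(cn)\big), \qquad n \to \infty.$$
   Context: $\mathbb{Z}_+=\{0,1,2,\dots\}$; $\ell^\infty(\mathbb{Z}_+;X)$ is the space of bounded $X$-valued sequences. $\mathbb{T}=\{\lambda\in\mathbb{C}:|\lambda|=1\}$ and $\mathbb{E}=\{\lambda\in\mathbb{C}:|\lambda|>1\}$. For $x\in\ell^\infty(\mathbb{Z}_+;X)$, the holomorphic function $G_x\colon\mathbb{E}\to X$ is defined by $G_x(\lambda)=\sum_{n=0}^\infty x_n\lambda^{-(n+1)}$. Boundary function: if $G\colon\mathbb{E}\to X$ is holomorphic, a function $F\in L^1_{\mathrm{loc}}(\mathbb{T}\setminus\{1\};X)$ is a boundary function for $G$ if $$\lim_{r\to1+}\int_{-\pi}^{\pi}\psi(\theta)G(re^{i\theta})\,d\theta=\int_{-\pi}^{\pi}\psi(\theta)F(e^{i\theta})\,d\theta$$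 for all (complex-valued) $\psi\in C([-\pi,\pi])$ with $0\notin\operatorname{supp}\psi$, where $\operatorname{supp}$ denotes closed support. Derivatives: $F^{(j)}$ denotes the $j$-th derivative of $F$ with respect to the variable on $\mathbb{T}$, i.e. $F'(\lambda)=\lim_{\mu\to\lambda,\ \mu\in\mathbb{T}}\frac{F(\mu)-F(\lambda)}{\mu-\lambda}$, iterated (equivalently $\frac{d}{d\theta}F(e^{i\theta})=ie^{i\theta}F'(e^{i\theta})$); $F\in C^\infty(\mathbb{T}\setminus\{1\};X)$ means all these derivatives exist and are continuous on $\mathbb{T}\setminus\{1\}$. The function $m_{\log}\colon(0,\pi]\to(0,\infty)$ is defined by $m_{\log}(\epsilon)=m(\epsilon)\log\left(1+\frac{m(\epsilon)}{\epsilon}\right)$. It is continuous, strictly decreasing and unbounded as $\epsilon\to0+$; $m_{\log}^{-1}$ is its inverse function, defined on $[m_{\log}(\pi),\infty)$, so that $m_{\log}^{-1}(cn)$ is defined for all sufficiently large $n$. *)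

(* Defs.v *)
From Stdlib Require Import Reals.
From Coquelicot Require Import Coquelicot.
Open Scope R_scope.

Definition bounded_seq {K : AbsRing} {V : NormedModule K} (u : nat -> V) : Prop :=
  exists B : R, forall n : nat, norm (u n) <= B.

Section RealScalars.

Variable X : CompleteNormedModule C_AbsRing.

Let rscal (a : R) (v : X) : X := scal (RtoC a : C_AbsRing) v.

Lemma rscal_assoc (a b : R) (v : X) : rscal a (rscal b v) = rscal (mult a b) v.
Proof.
unfold rscal; rewrite scal_assoc; f_equal.
exact (eq_sym (RtoC_mult a b)).
Qed.

Lemma rscal_one (v : X) : rscal one v = v.
Proof. exact (scal_one v). Qed.

Lemma rscal_distr_l (a : R) (u v : X) :
  rscal a (plus u v) = plus (rscal a u) (rscal a v).
Proof. exact (scal_distr_l _ _ _). Qed.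

Lemma rscal_distr_r (a b : R) (v : X) :
  rscal (plus a b) v = plus (rscal a v) (rscal b v).
Proof.
refine (eq_trans _ (scal_distr_r (RtoC a : C_AbsRing) (RtoC b : C_AbsRing) v)).
unfold rscal; f_equal.
exact (RtoC_plus a b).
Qed.

Lemma norm_rscal (a : R) (v : X) : norm (rscal a v) <= Rabs a * norm v.
Proof.
unfold rscal; rewrite <- Cmod_R.
exact (norm_scal (RtoC a : C_AbsRing) v).
Qed.

Definition real_ModuleSpace_class : ModuleSpace.class_of R_Ring X :=
  ModuleSpace.Class R_Ring X (AbelianGroup.class X)
    (ModuleSpace.Mixin R_Ring (AbelianGroup.Pack X (AbelianGroup.class X) X)
       rscal rscal_assoc rscal_one rscal_distr_l rscal_distr_r).

Definition real_NormedModuleAux_class : NormedModuleAux.class_of R_AbsRing X :=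
  NormedModuleAux.Class R_AbsRing X real_ModuleSpace_class (UniformSpace.class X).

Definition real_NormedModule_class : NormedModule.class_of R_AbsRing X :=
  NormedModule.Class R_AbsRing X real_NormedModuleAux_class
    (NormedModule.Mixin R_AbsRing
       (NormedModuleAux.Pack R_AbsRing X real_NormedModuleAux_class X)
       (@norm C_AbsRing X) (@norm_factor C_AbsRing X)
       norm_triangle norm_rscal norm_compat1 norm_compat2 norm_eq_zero).

(* X with scalars restricted to R; carrier, norm and uniform structure are
   unchanged.  Needed because RInt integrates into real normed modules. *)
Definition real_space : CompleteNormedModule R_AbsRing :=
  CompleteNormedModule.Pack R_AbsRing X
    (CompleteNormedModule.Class R_AbsRing X real_NormedModule_class
       (CompleteSpace.class X)) X.

End RealScalars.

Definition expi (t : R) : C := (cos t, sin t).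

Definition unit_circle (z : C) : Prop := Cmod z = 1.

Definition punctured_circle (z : C) : Prop := unit_circle z /\ z <> RtoC 1.

(* Meaningful for Cmod lam > 1 and bounded x, where the series converges. *)
Definition Gseries {X : CompleteNormedModule C_AbsRing} (x : nat -> X) (lam : C) : X :=
  iota (is_series (fun n : nat => scal (Cinv (Cpow lam (S n)) : C_AbsRing) (x n))).

(* Derivative with respect to the variable on the circle: mu tends to lam
   along the circle only, so F may be arbitrary off the circle. *)
Definition is_circle_derive {X : CompleteNormedModule C_AbsRing}
    (F : C -> X) (lam : C) (l : X) : Prop :=
  filterlim
    (fun mu : C => scal (Cinv (Cminus mu lam) : C_AbsRing) (minus (F mu) (F lam)))
    (within (fun mu : C => unit_circle mu /\ mu <> lam) (locally lam))
    (locally l).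

Definition circle_derive {X : CompleteNormedModule C_AbsRing}
    (F : C -> X) (lam : C) : X :=
  iota (is_circle_derive F lam).

Fixpoint circle_derive_n {X : CompleteNormedModule C_AbsRing}
    (F : C -> X) (j : nat) : C -> X :=
  match j with
  | O => F
  | S j' => circle_derive (circle_derive_n F j')
  end.

Definition smooth_punctured_circle {X : CompleteNormedModule C_AbsRing}
    (F : C -> X) : Prop :=
  forall j : nat,
    continuous_on punctured_circle (circle_derive_n F j) /\
    forall lam : C, punctured_circle lam ->
      exists l : X, is_circle_derive (circle_derive_n F j) lam l.

Definition base_interval (t : R) : Prop := - PI <= t <= PI.

Definition closed_support (psi : R -> C) (t : R) : Prop :=
  forall eps : posreal,
    exists s : R, base_interval s /\ Rabs (s - t) < eps /\ psi s <> RtoC 0.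

(* Integrals are Riemann integrals.  For F continuous on the punctured circle
   they agree with Bochner integrals: psi vanishes near 0, so both integrands
   are continuous on [-PI, PI] (the value of F at 1 is irrelevant).
   Local integrability is tested on the compact arcs
   { expi t : a <= t <= b }, 0 < a <= b < 2 * PI. *)
Definition is_boundary_function {X : CompleteNormedModule C_AbsRing}
    (G F : C -> X) : Prop :=
  (forall a b : R, 0 < a -> a <= b -> b < 2 * PI ->
     ex_RInt (V := real_space X) (fun t : R => F (expi t)) a b) /\
  (forall psi : R -> C,
     continuous_on base_interval psi ->
     ~ closed_support psi 0 ->
     filterlim
       (fun r : R =>
          RInt (V := real_space X)
            (fun t : R =>
               scal (psi t : C_AbsRing) (G (Cmult (RtoC r) (expi t)))) (- PI) PI)
       (at_right 1)
       (locally
          (RInt (V := real_space X)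
             (fun t : R => scal (psi t : C_AbsRing) (F (expi t))) (- PI) PI))).

Definition mlog (m : R -> R) (eps : R) : R := m eps * ln (1 + m eps / eps).

(* The inverse of mlog m : (0, PI] -> [mlog m PI, +oo[, which is a bijection
   when m is positive, continuous and non-increasing; unspecified for t
   outside the range. *)
Definition mlog_inv (m : R -> R) (t : R) : R :=
  iota (fun eps : R => 0 < eps <= PI /\ mlog m eps = t).

(* Main.v *)
(* Let eps = m_log^{-1}(cn), M = m(eps), and let h be the trapezoidal cutoff that vanishes on
   |theta| <= eps and equals 1 on |theta| >= 3 eps.  Test the boundary function with
   psi = h(theta) e^{i(n+1) theta}.

   On the side of G_x, termwise integration gives 2 pi x_n minus the sum of the x_k against the
   Fourier coefficients of 1 - h.  The increments of these coefficients have l^1 norm O(eps), so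
   by Abel summation against the bounded partial sums of x this error is O(eps), uniformly in r.

   On the side of F_x, integrate by parts k = floor(n / M) times, never differentiating h more
   than once per term: the boundary terms sum to O(eps) because j! (M/n)^{j+1} <= 1/k for j < k,
   and by Stirling the last integral is O(M k e^{-n/M}), which is O(eps) because
   M / eps <= e^{cn/M} and c < 1. *)

Require Import Defs.
From Stdlib Require Import Reals Factorial Lra Lia ZArith.
From Coquelicot Require Import Coquelicot.
Open Scope R_scope.

(** * Calculus on the circle *)

(** Every error has to come out proportional to eps, and this dictates the shape of h. Each of its
    two ramps has slope 1/(2 eps) and length 2 eps, so h' has L^1 norm 2 whatever eps is; the terms
    carrying h' then only see |theta| <= 3 eps, where the factor |theta| of the hypothesis supplies
    the eps. A smooth cutoff differentiated about n/M times would add powers of 1/eps and its own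
    derivative growth to j!. Leaving each h' term as it stands and integrating by parts again only
    in the term with h avoids both.

    The l^1 bound on increments is a scaling effect: the coefficients of 1 - h sample one fixed
    profile, a product of two sinc functions, at the points eps z, with eps in front. The profile
    has finite total variation, so only that eps remains. The radial factors r^(-(k+1)) are monotone
    in k, which is why the limit r -> 1+ costs nothing. *)

Lemma expi_plus (a b : R) : expi (a + b) = Cmult (expi a) (expi b).
Proof.
unfold expi, Cmult; simpl; rewrite cos_plus, sin_plus; f_equal; ring.
Qed.

Lemma Cmod_expi (t : R) : Cmod (expi t) = 1.
Proof.
unfold Cmod, expi; simpl.
replace (cos t * (cos t * 1) + sin t * (sin t * 1)) with (Rsqr (sin t) + Rsqr (cos t))
  by (unfold Rsqr; ring).
rewrite sin2_cos2; exact sqrt_1.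
Qed.

Lemma Cmod_Ci : Cmod Ci = 1.
Proof.
unfold Cmod, Ci; simpl.
replace (0 * (0 * 1) + 1 * (1 * 1)) with 1 by ring; exact sqrt_1.
Qed.

Lemma expi_0 : expi 0 = RtoC 1.
Proof. unfold expi; rewrite cos_0, sin_0; reflexivity. Qed.

Lemma Cinv_expi (t : R) : Cinv (expi t) = expi (- t).
Proof.
assert (H : expi t <> 0) by (apply Cmod_gt_0; rewrite Cmod_expi; lra).
rewrite <- (Cmult_1_r (Cinv (expi t))), <- expi_0, <- (Rplus_opp_r t), expi_plus, Cmult_assoc,
  Cinv_l, Cmult_1_l by exact H.
reflexivity.
Qed.

Lemma Cpow_expi (t : R) (k : nat) : Cpow (expi t) k = expi (INR k * t).
Proof.
induction k as [|k IH].
- simpl; rewrite Rmult_0_l, expi_0; reflexivity.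
- rewrite Cpow_S, IH, <- expi_plus; f_equal; rewrite S_INR; ring.
Qed.

Lemma expi_neq_1 (t : R) : 0 < Rabs t <= PI -> expi t <> RtoC 1.
Proof.
intros Ht H.
assert (Hc : cos (Rabs t) = 1).
{ unfold Rabs; destruct (Rcase_abs t); [rewrite cos_neg|]; exact (f_equal fst H). }
rewrite <- cos_0 in Hc.
assert (cos (Rabs t) < cos 0); [|lra].
pose proof PI_RGT_0; apply cos_decreasing_1; lra.
Qed.

Lemma expi_punctured (t : R) : 0 < Rabs t <= PI -> punctured_circle (expi t).
Proof.
intros Ht; split; [exact (Cmod_expi t)|exact (expi_neq_1 t Ht)].
Qed.

Lemma norm_scal_Cmod {X : CompleteNormedModule C_AbsRing} (z : C) (v : X) :
  norm (scal (z : C_AbsRing) v) <= Cmod z * norm v.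
Proof. exact (norm_scal (z : C_AbsRing) v). Qed.

Lemma scal_Cplus {X : CompleteNormedModule C_AbsRing} (a b : C) (v : X) :
  scal (Cplus a b : C_AbsRing) v = plus (scal (a : C_AbsRing) v) (scal (b : C_AbsRing) v).
Proof. exact (scal_distr_r (a : C_AbsRing) (b : C_AbsRing) v). Qed.

Lemma scal_Cmult {X : CompleteNormedModule C_AbsRing} (a b : C) (v : X) :
  scal (Cmult a b : C_AbsRing) v = scal (a : C_AbsRing) (scal (b : C_AbsRing) v).
Proof. exact (eq_sym (scal_assoc (a : C_AbsRing) (b : C_AbsRing) v)). Qed.

Lemma scal_Cplus_r {X : CompleteNormedModule C_AbsRing} (a : C) (u v : X) :
  scal (a : C_AbsRing) (plus u v) = plus (scal (a : C_AbsRing) u) (scal (a : C_AbsRing) v).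
Proof. exact (scal_distr_l (a : C_AbsRing) u v). Qed.

Lemma scal_Cminus_r {X : CompleteNormedModule C_AbsRing} (a : C) (u v : X) :
  scal (a : C_AbsRing) (minus u v) = minus (scal (a : C_AbsRing) u) (scal (a : C_AbsRing) v).
Proof.
unfold minus.
refine (eq_trans (scal_distr_l (a : C_AbsRing) u (opp v)) _); f_equal.
exact (scal_opp_r (a : C_AbsRing) v).
Qed.

Lemma scal_Cminus {X : CompleteNormedModule C_AbsRing} (a b : C) (v : X) :
  scal (Cminus a b : C_AbsRing) v = minus (scal (a : C_AbsRing) v) (scal (b : C_AbsRing) v).
Proof. exact (scal_minus_distr_r (a : C_AbsRing) (b : C_AbsRing) v). Qed.

Lemma norm_scal_expi {X : CompleteNormedModule C_AbsRing} (t : R) (v : X) :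
  norm (scal (expi t : C_AbsRing) v) <= norm v.
Proof.
eapply Rle_trans; [apply norm_scal_Cmod|]; rewrite Cmod_expi; lra.
Qed.

(** Multiplication by a complex number is a bounded linear map of the underlying real space, so it
    commutes with differentiation in a real variable. *)
Lemma is_derive_scal_C {X : CompleteNormedModule C_AbsRing} (z : C) (g : R -> X) (t : R) (l : X) :
  is_derive (V := real_space X) g t l ->
  is_derive (V := real_space X) (fun t => scal (z : C_AbsRing) (g t)) t (scal (z : C_AbsRing) l).
Proof.
intros H.
assert (L : is_linear (K := R_AbsRing) (U := real_space X) (V := real_space X)
              (fun v : X => scal (z : C_AbsRing) v)).
{ split.
  - intros u v; exact (scal_distr_l (z : C_AbsRing) (u : X) v).
  - intros k v.
    change (scal (z : C_AbsRing) (scal (RtoC k : C_AbsRing) (v : X))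
            = scal (RtoC k : C_AbsRing) (scal (z : C_AbsRing) (v : X))).
    rewrite !scal_assoc; f_equal; exact (Cmult_comm z (RtoC k)).
  - exists (Cmod z + 1); split; [pose proof (Cmod_ge_0 z); lra|].
    intros v; apply Rle_trans with (Cmod z * norm (v : X)); [exact (norm_scal_Cmod z v)|].
    change (Cmod z * norm (v : X) <= (Cmod z + 1) * norm (v : X)).
    pose proof (norm_ge_0 (v : X)); lra. }
unfold is_derive.
eapply filterdiff_ext_lin.
- apply (filterdiff_comp (U := R_NormedModule) (V := real_space X) (W := real_space X)
    g _ _ _ H (filterdiff_linear _ L)).
- intros k; simpl; exact (linear_scal _ L k l).
Qed.

(* Splitting the scalar into real and imaginary parts reduces to the product rule over R. *)
Lemma is_derive_expi_scal {X : CompleteNormedModule C_AbsRing} (s : R) (g : R -> X) (t : R) (l : X) :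
  is_derive (V := real_space X) g t l ->
  is_derive (V := real_space X) (fun t => scal (expi (s * t) : C_AbsRing) (g t)) t
    (plus (scal (Cmult (Cmult Ci (RtoC s)) (expi (s * t)) : C_AbsRing) (g t))
          (scal (expi (s * t) : C_AbsRing) l)).
Proof.
intros H.
assert (Dc : is_derive (fun t => cos (s * t)) t (- s * sin (s * t))) by (auto_derive; [trivial|ring]).
assert (Ds : is_derive (fun t => sin (s * t)) t (s * cos (s * t))) by (auto_derive; [trivial|ring]).
assert (Hc : forall n m : R_AbsRing, mult n m = mult m n) by (intros; apply Rmult_comm).
pose proof (filterdiff_scal_fct (K := R_AbsRing) (U := R_NormedModule) (V := real_space X) t
  _ _ _ _ Hc Dc H) as H1.
pose proof (filterdiff_scal_fct (K := R_AbsRing) (U := R_NormedModule) (V := real_space X) t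
  _ _ _ _ Hc Ds (is_derive_scal_C Ci _ _ _ H)) as H2.
assert (Hsplit : forall (u : R) (v : X), scal (expi u : C_AbsRing) v
   = plus (scal (RtoC (cos u) : C_AbsRing) v) (scal (RtoC (sin u) : C_AbsRing) (scal (Ci : C_AbsRing) v))).
{ intros u v; rewrite scal_assoc.
  refine (eq_trans _ (scal_distr_r _ _ v)); f_equal.
  change (expi u = Cplus (RtoC (cos u)) (Cmult (RtoC (sin u)) Ci)).
  unfold expi, Cplus, Cmult, RtoC, Ci; simpl; f_equal; ring. }
unfold is_derive.
eapply filterdiff_ext_lin.
- eapply filterdiff_ext; [|exact (filterdiff_plus_fct _ _ _ _ H1 H2)].
  intros u; simpl. symmetry; exact (Hsplit (s * u) (g u)).
- intros k; simpl.
  change (plus (plus (scal (RtoC (k * (- s * sin (s * t))) : C_AbsRing) (g t))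
                  (scal (RtoC (cos (s * t)) : C_AbsRing) (scal (RtoC k : C_AbsRing) l)))
    (plus (scal (RtoC (k * (s * cos (s * t))) : C_AbsRing) (scal (Ci : C_AbsRing) (g t)))
          (scal (RtoC (sin (s * t)) : C_AbsRing) (scal (RtoC k : C_AbsRing) (scal (Ci : C_AbsRing) l))))
    = scal (RtoC k : C_AbsRing) (plus (scal (Cmult (Cmult Ci (RtoC s)) (expi (s * t)) : C_AbsRing) (g t))
          (scal (expi (s * t) : C_AbsRing) l))).
  rewrite !scal_distr_l, !scal_assoc.
  assert (E : forall (a b c d e f : C) (v w : X), Cplus a c = e -> Cplus b d = f ->
     plus (plus (scal (a : C_AbsRing) v) (scal (b : C_AbsRing) w))
       (plus (scal (c : C_AbsRing) v) (scal (d : C_AbsRing) w))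
     = plus (scal (e : C_AbsRing) v) (scal (f : C_AbsRing) w)).
  { intros a b c d e f v w <- <-.
    rewrite !scal_Cplus, <- !plus_assoc; f_equal.
    rewrite !plus_assoc; f_equal; apply plus_comm. }
  apply E; unfold mult, expi; simpl; unfold Cplus, Cmult, RtoC, Ci; simpl; f_equal; ring.
Qed.

Lemma continuous_expi (t : R) : continuous (T := R_UniformSpace) (U := C_UniformSpace) expi t.
Proof.
refine (continuous_comp_2 (U := R_UniformSpace) (V := R_UniformSpace) (W := R_UniformSpace)
  (X := C_UniformSpace) cos sin pair t _ _ _).
- apply (ex_derive_continuous (K := R_AbsRing) (V := R_NormedModule)); auto_derive; trivial.
- apply (ex_derive_continuous (K := R_AbsRing) (V := R_NormedModule)); auto_derive; trivial.
- intros P HP; unfold filtermap.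
  refine (filter_imp P _ _ HP); intros [u v] h; exact h.
Qed.

(** [iota] returns the derivative only once it is unique. Limits along the circle are unique because
    [expi x] is not isolated there: the points [expi (x + t)] with small [t > 0] approach it and
    differ from it. *)
Lemma circle_derive_correct {X : CompleteNormedModule C_AbsRing} (F : C -> X) (x : R) :
  (exists l, is_circle_derive F (expi x) l) ->
  is_circle_derive F (expi x) (circle_derive F (expi x)).
Proof.
intros [l Hl]; unfold circle_derive; apply iota_correct.
exists l; split; [exact Hl|].
intros l' Hl'.
refine (filterlim_locally_unique (FF := _) _ _ _ Hl Hl').
split; [|apply within_filter, locally_filter].
intros Hd.
assert (Hloc := continuous_expi x _ Hd).
destruct Hloc as [e He].
pose proof (cond_pos e); pose proof PI_RGT_0.
set (t := Rmin (e / 2) PI).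
assert (Ht : 0 < t <= PI) by (unfold t; split; [apply Rmin_glb_lt; lra|apply Rmin_r]).
assert (Hte : t < e) by (unfold t; pose proof (Rmin_l (e / 2) PI); lra).
refine (He (x + t) _ _).
- change (Rabs (x + t - x) < e). replace (x + t - x) with t by ring. rewrite Rabs_pos_eq; lra.
- split; [exact (Cmod_expi _)|].
  intros Heq. apply (expi_neq_1 t); [rewrite Rabs_pos_eq; lra|].
  replace t with (- x + (x + t)) by ring.
  rewrite expi_plus, Heq, <- expi_plus, Rplus_opp_l; exact expi_0.
Qed.

Lemma Cmod_le_Rabs (z : C) : Cmod z <= Rabs (fst z) + Rabs (snd z).
Proof.
rewrite <- Cmod_R, <- (Cmod_R (snd z)).
replace (Cmod (RtoC (snd z))) with (Cmod (Cmult Ci (RtoC (snd z)))).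
- replace z with (Cplus (RtoC (fst z)) (Cmult Ci (RtoC (snd z)))) at 1; [apply Cmod_triangle|].
  destruct z as [u v]; unfold Cplus, Cmult, RtoC, Ci; simpl; f_equal; ring.
- rewrite Cmod_mult, Cmod_Ci; ring.
Qed.

Lemma expi_first_order (x : R) (d : posreal) :
  locally x (fun y => Cmod (Cminus (Cminus (expi y) (expi x)) (Cmult (Cmult Ci (expi x)) (RtoC (y - x))))
                      <= d * Rabs (y - x)).
Proof.
assert (Hd : 0 < d / 2) by (pose proof (cond_pos d); lra).
assert (Dc : is_derive cos x (- sin x)) by (auto_derive; [trivial|ring]).
assert (Ds : is_derive sin x (cos x)) by (auto_derive; [trivial|ring]).
generalize (filter_and _ _ (proj2 Dc x (fun P H => H) (mkposreal _ Hd))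
  (proj2 Ds x (fun P H => H) (mkposreal _ Hd))).
apply filter_imp; intros y [H1 H2].
change (Rabs (cos y - cos x - (y - x) * (- sin x)) <= d / 2 * Rabs (y - x)) in H1.
change (Rabs (sin y - sin x - (y - x) * cos x) <= d / 2 * Rabs (y - x)) in H2.
eapply Rle_trans; [apply Cmod_le_Rabs|].
unfold expi, Cplus, Cminus, Copp, Cmult, RtoC, Ci; simpl.
replace (cos y + - cos x + - ((0 * cos x - 1 * sin x) * (y - x) - (0 * sin x + 1 * cos x) * 0))
  with (cos y - cos x - (y - x) * (- sin x)) by ring.
replace (sin y + - sin x + - ((0 * cos x - 1 * sin x) * 0 + (0 * sin x + 1 * cos x) * (y - x)))
  with (sin y - sin x - (y - x) * cos x) by ring.
lra.
Qed.

(** Chain rule for an outer function differentiable only along the circle. With [D] the difference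
    quotient and [r] the first-order Taylor remainder of [expi], the error to control is
    [(mu - lam) (D - l) + r l]. *)
Lemma is_circle_derive_expi {X : CompleteNormedModule C_AbsRing} (F : C -> X) (x : R) (l : X) :
  is_circle_derive F (expi x) l ->
  is_derive (V := real_space X) (fun t => F (expi t)) x (scal (Cmult Ci (expi x) : C_AbsRing) l).
Proof.
intros H; split.
- apply is_linear_scal_l.
- intros x' Hx' eps.
  assert (x' = x) as -> by (symmetry; apply (is_filter_lim_locally_unique (V := R_NormedModule) x x' Hx')).
  pose proof (cond_pos eps); pose proof (norm_ge_0 l).
  (* The bound 1 in the minimum gives [Cmod (mu - lam) <= 2 |y - x|], so a quotient error of eps/6
     costs eps/3; the other bound makes [r l] cost at most eps/2. *)
  assert (P1 : 0 < eps / 6) by lra.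
  assert (P2 : 0 < Rmin 1 (eps / (2 * (norm l + 1)))).
  { apply Rmin_glb_lt; [lra|apply Rdiv_lt_0_compat; lra]. }
  assert (B1 := proj1 (filterlim_locally_ball_norm _ _) H (mkposreal _ P1)).
  assert (B1' := continuous_expi x _ B1).
  unfold filtermap in B1'.
  generalize (filter_and _ _ B1' (expi_first_order x (mkposreal _ P2))).
  apply filter_imp; intros y [A1 A2]; simpl in A2.
  change (norm (minus (minus (F (expi y)) (F (expi x)))
            (scal (RtoC (y - x) : C_AbsRing) (scal (Cmult Ci (expi x) : C_AbsRing) l)))
          <= eps * Rabs (y - x)).
  set (mu := expi y) in *; set (lam := expi x) in *.
  set (r := Cminus (Cminus mu lam) (Cmult (Cmult Ci lam) (RtoC (y - x)))) in *.
  pose proof (Rabs_pos (y - x)) as Py.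
  assert (A3 : Cmod (Cminus mu lam) <= 2 * Rabs (y - x)).
  { replace (Cminus mu lam) with (Cplus r (Cmult (Cmult Ci lam) (RtoC (y - x)))) by (unfold r; ring).
    eapply Rle_trans; [apply Cmod_triangle|].
    rewrite !Cmod_mult, Cmod_R; unfold lam at 1; rewrite Cmod_expi.
    rewrite Cmod_Ci.
    pose proof (Rmin_l 1 (eps / (2 * (norm l + 1)))). nra. }
  assert (A4 : Cmod r * norm l <= eps / 2 * Rabs (y - x)).
  { apply Rle_trans with (Rmin 1 (eps / (2 * (norm l + 1))) * Rabs (y - x) * norm l);
      [apply Rmult_le_compat_r; lra|].
    apply Rle_trans with (eps / (2 * (norm l + 1)) * Rabs (y - x) * norm l).
    - apply Rmult_le_compat_r; [lra|]; apply Rmult_le_compat_r; [lra|apply Rmin_r].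
    - replace (eps / (2 * (norm l + 1)) * Rabs (y - x) * norm l)
        with (eps / 2 * Rabs (y - x) * (norm l / (norm l + 1))) by (field; lra).
      assert (norm l / (norm l + 1) <= 1) by (apply Rle_div_l; lra).
      assert (0 <= eps / 2 * Rabs (y - x)) by nra.
      nra. }
  (* For [mu = lam] the difference quotient carries no information, but then the increment of [F]
     vanishes and the linear term is exactly [- r l], which [A4] already bounds. *)
  destruct (Ceq_dec mu lam) as [E|E].
  + assert (Er : minus (F mu) (F lam) = zero) by (rewrite E; apply minus_eq_zero).
    rewrite Er.
    replace (scal (RtoC (y - x) : C_AbsRing) (scal (Cmult Ci lam : C_AbsRing) l))
      with (scal (Copp r : C_AbsRing) l).
    * unfold minus; rewrite plus_zero_l.
      eapply Rle_trans; [apply Req_le, (norm_opp (scal (Copp r : C_AbsRing) l))|].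
      eapply Rle_trans; [apply norm_scal_Cmod|]. rewrite Cmod_opp. nra.
    * rewrite <- scal_Cmult; f_equal; unfold r; rewrite E; ring.
  + set (D := scal (Cinv (Cminus mu lam) : C_AbsRing) (minus (F mu) (F lam))).
    assert (HD : norm (minus D l) < eps / 6) by (apply A1; split; [apply Cmod_expi|exact E]).
    replace (minus (minus (F mu) (F lam))
        (scal (RtoC (y - x) : C_AbsRing) (scal (Cmult Ci lam : C_AbsRing) l)))
      with (plus (scal (Cminus mu lam : C_AbsRing) (minus D l)) (scal (r : C_AbsRing) l)).
    * eapply Rle_trans; [exact (norm_triangle (V := X) _ _)|].
      assert (T1 := norm_scal_Cmod (Cminus mu lam) (minus D l)).
      assert (T2 := norm_scal_Cmod r l).
      pose proof (norm_ge_0 (minus D l)). pose proof (Cmod_ge_0 (Cminus mu lam)).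
      nra.
    * assert (HE : scal (Cminus mu lam : C_AbsRing) D = minus (F mu) (F lam)).
      { unfold D; rewrite <- scal_Cmult, Cinv_r; [apply (scal_one (minus (F mu) (F lam)))|].
        intros E'; apply E. replace mu with (Cplus (Cminus mu lam) lam) by ring. rewrite E'; ring. }
      replace r with (Cminus (Cminus mu lam) (Cmult (RtoC (y - x)) (Cmult Ci lam))) by (unfold r; ring).
      rewrite <- HE, <- scal_Cmult.
      refine (eq_trans (f_equal2 _ (scal_Cminus_r (Cminus mu lam) D l) (scal_Cminus _ _ l)) _).
      exact (eq_sym (minus_trans (G := X) _ _ _)).
Qed.

Lemma is_derive_circle_derive_n {X : CompleteNormedModule C_AbsRing} (F : C -> X) (j : nat) (x : R) :
  smooth_punctured_circle F -> 0 < Rabs x <= PI ->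
  is_derive (V := real_space X) (fun t => circle_derive_n F j (expi t)) x
    (scal (Cmult Ci (expi x) : C_AbsRing) (circle_derive_n F (S j) (expi x))).
Proof.
intros HF Hx; apply is_circle_derive_expi, circle_derive_correct.
exact (proj2 (HF j) _ (expi_punctured x Hx)).
Qed.

(** * The trapezoidal cutoff *)

Definition cutoff (e t : R) : R := Rmin 1 (Rmax 0 ((Rabs t - e) / (2 * e))).

Lemma cutoff_bounds (e t : R) : 0 <= cutoff e t <= 1.
Proof.
unfold cutoff; split; [|apply Rmin_l].
apply Rmin_glb; [lra|apply Rmax_l].
Qed.

Lemma cutoff_opp (e t : R) : cutoff e (- t) = cutoff e t.
Proof. unfold cutoff; rewrite Rabs_Ropp; reflexivity. Qed.

Lemma cutoff_near (e t : R) : 0 < e -> Rabs t <= e -> cutoff e t = 0.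
Proof.
intros He Ht; unfold cutoff.
rewrite Rmax_left, Rmin_right; [reflexivity|lra|].
apply Rle_div_l; lra.
Qed.

Lemma cutoff_ramp (e t : R) : 0 < e -> e <= t <= 3 * e -> cutoff e t = / (2 * e) * t + - / 2.
Proof.
intros He Ht; unfold cutoff.
rewrite Rabs_pos_eq by lra.
replace (/ (2 * e) * t + - / 2) with ((t - e) / (2 * e)) by (field; lra).
rewrite Rmax_right, Rmin_right; [reflexivity| |].
- apply Rle_div_l; lra.
- apply Rle_div_r; lra.
Qed.

Lemma cutoff_far (e t : R) : 0 < e -> 3 * e <= Rabs t -> cutoff e t = 1.
Proof.
intros He Ht; unfold cutoff.
assert (1 <= (Rabs t - e) / (2 * e)) by (apply Rle_div_r; lra).
rewrite Rmax_right, Rmin_left; lra.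
Qed.

(** Clamping to [0, 1] is 1-Lipschitz, so [cutoff e] has Lipschitz constant [1 / (2 * e)]; hence the
    radius [2 * e * d]. *)
Lemma continuous_cutoff (e t : R) : 0 < e -> continuous (cutoff e) t.
Proof.
intros He; apply (filterlim_locally (F := locally t)); intros d.
assert (Hd : 0 < 2 * e * d) by (pose proof (cond_pos d); nra).
exists (mkposreal _ Hd); intros y Hy.
change (Rabs (y - t) < 2 * e * d) in Hy.
change (Rabs (cutoff e y - cutoff e t) < d).
assert (L : forall a b, Rabs (Rmin 1 (Rmax 0 a) - Rmin 1 (Rmax 0 b)) <= Rabs (a - b)).
{ intros a b; unfold Rmax; destruct (Rle_dec 0 a), (Rle_dec 0 b);
  unfold Rmin; repeat destruct (Rle_dec 1 _); unfold Rabs; repeat destruct (Rcase_abs _); lra. }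
eapply Rle_lt_trans; [apply L|].
replace ((Rabs y - e) / (2 * e) - (Rabs t - e) / (2 * e)) with ((Rabs y - Rabs t) / (2 * e))
  by (field; lra).
rewrite Rabs_div, (Rabs_pos_eq (2 * e)) by lra.
apply Rlt_div_l; [lra|].
pose proof (Rabs_triang_inv2 y t); lra.
Qed.

(** * Integration by parts against a piecewise linear weight *)

Lemma minusE {G : AbelianGroup} (u v : G) : minus u v = plus u (opp v).
Proof. reflexivity. Qed.

(** The left side lists the contributions of the five linear pieces of the cutoff from left to
    right. The values [a] and [c] of the primitive at the outer kinks cancel; the endpoints and the
    two ramp averages [b], [d] remain. *)
Lemma minus_telescope {G : AbelianGroup} (p a b c d f : G) :
  plus (plus (minus a p) (minus b a)) (plus zero (plus (minus c d) (minus f c)))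
  = minus (minus f p) (minus d b).
Proof.
rewrite plus_zero_l, (plus_comm (minus c d)), <- minus_trans, (plus_comm (minus a p)), <- minus_trans.
rewrite !minusE, opp_plus, opp_opp, <- !plus_assoc, (plus_comm b), (plus_comm f), (plus_comm f),
  <- !plus_assoc; f_equal.
f_equal; apply plus_comm.
Qed.

Lemma minus_plus_l {G : AbelianGroup} (u v : G) : minus (plus u v) u = v.
Proof.
rewrite minusE, (plus_comm u v), <- plus_assoc, plus_opp_r; apply plus_zero_r.
Qed.

Lemma minus_zero_opp {G : AbelianGroup} (u v : G) : minus (minus zero u) (opp v) = minus v u.
Proof. rewrite !minusE, opp_opp, plus_zero_l; apply plus_comm. Qed.

Lemma is_RInt_affine_parts {V : CompleteNormedModule R_AbsRing} (Q q : R -> V) (al be a b : R) (I : V) :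
  a <= b ->
  (forall t, a <= t <= b -> is_derive Q t (q t)) ->
  (forall t, a <= t <= b -> continuous q t) ->
  is_RInt Q a b I ->
  is_RInt (fun t => scal (al * t + be) (q t)) a b
    (minus (minus (scal (al * b + be) (Q b)) (scal (al * a + be) (Q a))) (scal al I)).
Proof.
intros Hab HQ Hq HI.
assert (Hc : forall n m : R_AbsRing, mult n m = mult m n) by (intros; apply Rmult_comm).
assert (Hd : forall t, is_derive (K := R_AbsRing) (V := R_NormedModule) (fun t => al * t + be) t al)
  by (intros t; auto_derive; [trivial|ring]).
assert (Hca : forall t, continuous (fun t => al * t + be) t).
{ intros t; apply (ex_derive_continuous (K := R_AbsRing) (V := R_NormedModule)); exists al; apply Hd. }
assert (H := is_RInt_derive (V := V) (fun t => scal (al * t + be) (Q t))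
   (fun t => plus (scal al (Q t)) (scal (al * t + be) (q t))) a b).
rewrite Rmin_left, Rmax_right in H by exact Hab.
apply (is_RInt_ext (fun t => minus (plus (scal al (Q t)) (scal (al * t + be) (q t))) (scal al (Q t)))).
- intros t _; apply (minus_plus_l (G := V)).
- apply (is_RInt_minus (V := V)); [|apply (is_RInt_scal (V := V)); exact HI].
  apply H.
  + intros t Ht; unfold is_derive.
    eapply filterdiff_ext_lin.
    * exact (filterdiff_scal_fct (K := R_AbsRing) (U := R_NormedModule) (V := V) t _ _ _ _ Hc (Hd t) (HQ t Ht)).
    * intros k; simpl. rewrite scal_distr_l, !scal_assoc.
      change (plus (scal (k * al) (Q t)) (scal ((al * t + be) * k) (q t))
        = plus (scal (k * al) (Q t)) (scal (k * (al * t + be)) (q t))).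
      rewrite (Rmult_comm k (al * t + be)); reflexivity.
  + intros t Ht.
    apply (continuous_plus (V := V)).
    * apply (continuous_scal_r (V := V)).
      apply (ex_derive_continuous (K := R_AbsRing) (V := V)); exists (q t); apply HQ, Ht.
    * apply (continuous_scal (V := V)); [apply Hca|apply Hq, Ht].
Qed.

(* Trapezoidal weight: the integral of h q, with Q a primitive of q, is computed by parts on each
   linear piece of h. *)
Lemma is_RInt_cutoff_parts {V : CompleteNormedModule R_AbsRing} (Q q : R -> V) (e : R) (I1 I2 : V) :
  0 < e -> 3 * e <= PI ->
  (forall t, e <= Rabs t <= PI -> is_derive Q t (q t)) ->
  (forall t, e <= Rabs t <= PI -> continuous q t) ->
  is_RInt Q e (3 * e) I1 -> is_RInt Q (- (3 * e)) (- e) I2 ->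
  is_RInt (fun t => scal (cutoff e t) (q t)) (- PI) PI
    (minus (minus (Q PI) (Q (- PI))) (scal (/ (2 * e)) (minus I1 I2))).
Proof.
intros He HeP HQ Hq H1 H2.
assert (Pos : forall t, e <= t <= PI -> e <= Rabs t <= PI) by (intros; rewrite Rabs_pos_eq; lra).
assert (Neg : forall t, - PI <= t <= - e -> e <= Rabs t <= PI) by (intros; rewrite Rabs_left; lra).
assert (J1 : is_RInt (fun t => scal (cutoff e t) (q t)) (- PI) (- (3 * e)) (minus (Q (- (3 * e))) (Q (- PI)))).
{ apply (is_RInt_ext q).
  - intros t; rewrite Rmin_left, Rmax_right by lra; intros Ht.
    rewrite cutoff_far; [symmetry; apply (scal_one (q t))|lra|rewrite Rabs_left; lra].
  - apply (is_RInt_derive (V := V)); rewrite Rmin_left, Rmax_right by lra; intros t Ht;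
      [apply HQ|apply Hq]; apply Neg; lra. }
assert (J5 : is_RInt (fun t => scal (cutoff e t) (q t)) (3 * e) PI (minus (Q PI) (Q (3 * e)))).
{ apply (is_RInt_ext q).
  - intros t; rewrite Rmin_left, Rmax_right by lra; intros Ht.
    rewrite cutoff_far; [symmetry; apply (scal_one (q t))|lra|rewrite Rabs_pos_eq; lra].
  - apply (is_RInt_derive (V := V)); rewrite Rmin_left, Rmax_right by lra; intros t Ht;
      [apply HQ|apply Hq]; apply Pos; lra. }
assert (J3 : is_RInt (fun t => scal (cutoff e t) (q t)) (- e) e zero).
{ apply (is_RInt_ext (fun _ => zero)).
  - intros t; rewrite Rmin_left, Rmax_right by lra; intros Ht.
    rewrite cutoff_near; [symmetry; apply (scal_zero_l (q t))|lra|apply Rabs_le; lra].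
  - assert (Hz := is_RInt_const (- e) e (zero : V)). exact (eq_rect _ (is_RInt (V := V) _ _ _) Hz _ (scal_zero_r (e - - e))). }
assert (J4 : is_RInt (fun t => scal (cutoff e t) (q t)) e (3 * e)
               (minus (Q (3 * e)) (scal (/ (2 * e)) I1))).
{ apply (is_RInt_ext (fun t => scal (/ (2 * e) * t + - / 2) (q t))).
  - intros t; rewrite Rmin_left, Rmax_right by lra; intros Ht.
    rewrite cutoff_ramp; [reflexivity|lra|lra].
  - replace (minus (Q (3 * e)) (scal (/ (2 * e)) I1)) with
      (minus (minus (scal (/ (2 * e) * (3 * e) + - / 2) (Q (3 * e)))
        (scal (/ (2 * e) * e + - / 2) (Q e))) (scal (/ (2 * e)) I1)).
    + apply is_RInt_affine_parts; [lra| | |exact H1]; intros t Ht; [apply HQ|apply Hq]; apply Pos; lra.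
    + replace (/ (2 * e) * (3 * e) + - / 2) with 1 by (field; lra).
      replace (/ (2 * e) * e + - / 2) with 0 by (field; lra).
      f_equal. refine (eq_trans (f_equal2 minus (scal_one _) (scal_zero_l _)) _).
      exact (minus_zero_r (G := V) _). }
assert (J2 : is_RInt (fun t => scal (cutoff e t) (q t)) (- (3 * e)) (- e)
               (minus (scal (/ (2 * e)) I2) (Q (- (3 * e))))).
{ apply (is_RInt_ext (fun t => scal (- / (2 * e) * t + - / 2) (q t))).
  - intros t; rewrite Rmin_left, Rmax_right by lra; intros Ht.
    rewrite <- cutoff_opp, cutoff_ramp; [f_equal; ring|lra|lra].
  - replace (minus (scal (/ (2 * e)) I2) (Q (- (3 * e)))) with
      (minus (minus (scal (- / (2 * e) * (- e) + - / 2) (Q (- e)))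
        (scal (- / (2 * e) * - (3 * e) + - / 2) (Q (- (3 * e))))) (scal (- / (2 * e)) I2)).
    + apply is_RInt_affine_parts; [lra| | |exact H2]; intros t Ht; [apply HQ|apply Hq]; apply Neg; lra.
    + replace (- / (2 * e) * - (3 * e) + - / 2) with 1 by (field; lra).
      replace (- / (2 * e) * (- e) + - / 2) with 0 by (field; lra).
      refine (eq_trans (f_equal2 minus (f_equal2 minus (scal_zero_l _) (scal_one _))
         (scal_opp_l (/ (2 * e)) I2)) _).
      exact (minus_zero_opp (G := V) _ _). }
assert (J := is_RInt_Chasles _ _ _ _ _ _ (is_RInt_Chasles _ _ _ _ _ _ J1 J2)
  (is_RInt_Chasles _ _ _ _ _ _ J3 (is_RInt_Chasles _ _ _ _ _ _ J4 J5))).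
refine (eq_rect _ (is_RInt (V := V) _ _ _) J _ _).
refine (eq_trans (minus_telescope (G := V) _ _ _ _ _ _) _); f_equal.
symmetry; refine (eq_trans (scal_distr_l _ I1 (opp I2)) _).
exact (f_equal (plus _) (scal_opp_r _ I2)).
Qed.

(** * Fourier coefficients of the cutoff *)

(** By the mean value theorem neither [g - f] nor [g + f] decreases from [a] to [b]. Variations are
    thus bounded through an explicit primitive, with no integral of [|f'|]. *)
Lemma increment_le (f g f' g' : R -> R) (a b : R) :
  a <= b ->
  (forall t, a <= t <= b -> is_derive f t (f' t)) ->
  (forall t, a <= t <= b -> is_derive g t (g' t)) ->
  (forall t, a <= t <= b -> Rabs (f' t) <= g' t) ->
  Rabs (f b - f a) <= g b - g a.
Proof.
intros Hab Hf Hg H.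
assert (K : forall s, s = 1 \/ s = -1 -> s * (f b - f a) <= g b - g a).
{ intros s Hs.
  assert (D : forall t, a <= t <= b -> is_derive (fun t => g t - s * f t) t (g' t - s * f' t)).
  { intros t Ht.
    apply (is_derive_minus (K := R_AbsRing) (V := R_NormedModule)); [apply Hg, Ht|].
    apply (is_derive_scal f); apply Hf, Ht. }
  destruct (MVT_gen (fun t => g t - s * f t) a b (fun t => g' t - s * f' t)) as [c [Hc E]].
  - rewrite Rmin_left, Rmax_right by lra; intros t Ht; apply D; lra.
  - rewrite Rmin_left, Rmax_right by lra; intros t Ht.
    apply continuity_pt_filterlim.
    apply (ex_derive_continuous (K := R_AbsRing) (V := R_NormedModule) (fun t => g t - s * f t)).
    eexists; apply D, Ht.
  - rewrite Rmin_left, Rmax_right in Hc by lra.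
    assert (0 <= g' c - s * f' c).
    { specialize (H c Hc). pose proof (Rle_abs (f' c)); pose proof (Rle_abs (- f' c)).
      rewrite Rabs_Ropp in *. destruct Hs as [-> | ->]; lra. }
    nra. }
apply Rabs_le; pose proof (K 1 (or_introl eq_refl)); pose proof (K (-1) (or_intror eq_refl)); lra.
Qed.

Lemma Rabs_sin_le (t : R) : 0 <= t -> Rabs (sin t) <= t.
Proof.
intros Ht.
replace (sin t) with (sin t - sin 0) by (rewrite sin_0; ring).
replace t with (t - 0) at 2 by ring.
apply (increment_le sin (fun t => t) cos (fun _ => 1)); [exact Ht| | |].
- intros; auto_derive; [trivial|ring].
- intros; auto_derive; [trivial|ring].
- intros u _; apply Rabs_le, COS_bound.
Qed.

(** One decay rate covers both regimes: [|sin u| <= u] near 0 and [|sin u| <= 1] far out. A product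
    of two such bounds is of order [1 / (1 + u)^2], whose primitive [u / (1 + u)] is bounded. *)
Lemma sinc_bound (u : R) : 0 < u -> Rabs (sin u / u) <= 2 / (1 + u).
Proof.
intros Hu; rewrite Rabs_div, (Rabs_pos_eq u) by lra.
assert (Rabs (sin u) <= 1) by (apply Rabs_le, SIN_bound).
assert (Rabs (sin u) <= u) by (apply Rabs_sin_le; lra).
apply Rle_div_l; [lra|].
replace (2 / (1 + u) * u) with ((2 * u) / (1 + u)) by (field; lra).
apply Rle_div_r; [lra|]; nra.
Qed.

(** The quotient is the derivative of [sin u / u]. Its numerator has derivative [- u * sin u], hence
    is at most [u ^ 2], which serves near 0; the bound [u + 1] serves far out. *)
Lemma sinc'_bound (u : R) : 0 < u -> Rabs ((u * cos u - sin u) / u ^ 2) <= 4 / (1 + u).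
Proof.
intros Hu.
assert (Hc := COS_bound u); assert (Hs := SIN_bound u).
assert (Rabs (u * cos u - sin u) <= u ^ 2).
{ replace (u * cos u - sin u) with ((u * cos u - sin u) - (0 * cos 0 - sin 0)) by (rewrite sin_0; ring).
  replace (u ^ 2) with (u ^ 2 - 0 ^ 2) by ring.
  apply (increment_le (fun u => u * cos u - sin u) (fun u => u ^ 2) (fun u => - u * sin u) (fun u => 2 * u)); [lra| | |].
  - intros; auto_derive; [trivial|ring].
  - intros; auto_derive; [trivial|ring].
  - intros t Ht; rewrite Rabs_mult, Rabs_Ropp, (Rabs_pos_eq t) by lra.
    assert (Rabs (sin t) <= 1) by (apply Rabs_le, SIN_bound); nra. }
assert (Rabs (u * cos u - sin u) <= u + 1) by (apply Rabs_le; nra).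
rewrite Rabs_div, (Rabs_pos_eq (u ^ 2)) by nra.
apply Rle_div_l; [nra|].
replace (4 / (1 + u) * u ^ 2) with ((4 * u ^ 2) / (1 + u)) by (field; lra).
apply Rle_div_r; [lra|]; destruct (Rle_dec u 1); nra.
Qed.

(** This is the Fourier transform of the trapezoid that is 1 on [-1, 1] and 0 outside [-3, 3]. The
    trapezoid is half the convolution of the indicators of [-2, 2] and [-1, 1], whence the product
    of two sinc functions in the next lemma. *)
Definition ramp_kernel (u : R) : R := (cos u - cos (3 * u)) / u ^ 2.

Lemma ramp_kernel_sinc (u : R) : 0 < u -> ramp_kernel u = 4 * (sin (2 * u) / (2 * u)) * (sin u / u).
Proof.
intros Hu; unfold ramp_kernel.
replace (cos u - cos (3 * u)) with (2 * sin (2 * u) * sin u); [field; lra|].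
replace u with (2 * u - u) at 3 by ring; replace (3 * u) with (2 * u + u) by ring.
rewrite cos_minus, cos_plus; ring.
Qed.

Lemma ramp_kernel_bound (u : R) : 0 < u -> Rabs (ramp_kernel u) <= 4.
Proof.
intros Hu.
assert (S : forall v, 0 < v -> Rabs (sin v / v) <= 1).
{ intros v Hv; rewrite Rabs_div, (Rabs_pos_eq v) by lra.
  apply Rle_div_l; [lra|]. pose proof (Rabs_sin_le v). lra. }
rewrite ramp_kernel_sinc, !Rabs_mult, (Rabs_pos_eq 4) by lra.
pose proof (S u Hu); pose proof (S (2 * u)). pose proof (Rabs_pos (sin u / u)).
pose proof (Rabs_pos (sin (2 * u) / (2 * u))). nra.
Qed.

(** Each term of the derivative is a sinc times a derivative of a sinc, so it is of order
    [1 / (1 + u)^2]. The constant is 96 = 4 (2 * 8 + 8), where 8 bounds each such product and the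
    inner 2 comes from differentiating at [2 * u]. *)
Lemma ramp_kernel_increment (u v : R) : 0 < u -> u <= v ->
  Rabs (ramp_kernel v - ramp_kernel u) <= 96 * (v / (1 + v)) - 96 * (u / (1 + u)).
Proof.
intros Hu Huv; rewrite !ramp_kernel_sinc by lra.
apply (increment_le (fun u => 4 * (sin (2 * u) / (2 * u)) * (sin u / u)) (fun u => 96 * (u / (1 + u)))
  (fun u => 4 * (2 * ((2 * u * cos (2 * u) - sin (2 * u)) / (2 * u) ^ 2) * (sin u / u)
                 + (sin (2 * u) / (2 * u)) * ((u * cos u - sin u) / u ^ 2)))
  (fun u => 96 / (1 + u) ^ 2)); [exact Huv| | |].
- intros t Ht; auto_derive; [repeat split; lra|field; lra].
- intros t Ht; auto_derive; [repeat split; lra|field; lra].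
- intros t [Ht _]; assert (Ht0 : 0 < t) by lra; clear Ht.
  rewrite Rabs_mult, (Rabs_pos_eq 4) by lra.
  assert (A1 := sinc_bound t Ht0). assert (A2 := sinc'_bound t Ht0).
  assert (A3 := sinc_bound (2 * t) ltac:(lra)). assert (A4 := sinc'_bound (2 * t) ltac:(lra)).
  assert (M : forall k, 0 < k -> k / (1 + 2 * t) <= k / (1 + t)).
  { intros k Hk; unfold Rdiv; apply Rmult_le_compat_l; [lra|apply Rinv_le_contravar; lra]. }
  pose proof (M 2 ltac:(lra)); pose proof (M 4 ltac:(lra)); clear M.
  set (d := / (1 + t)).
  assert (Hd : 0 < d) by (apply Rinv_0_lt_compat; lra).
  replace (96 / (1 + t) ^ 2) with (96 * (d * d)) by (unfold d; field; lra).
  unfold Rdiv in *; fold d in A1, A2, H, H0.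
  set (a := sin t * / t) in *; set (b := (t * cos t - sin t) * / t ^ 2) in *.
  set (a' := sin (2 * t) * / (2 * t)) in *.
  set (b' := (2 * t * cos (2 * t) - sin (2 * t)) * / (2 * t) ^ 2) in *.
  eapply Rle_trans; [apply Rmult_le_compat_l; [lra|apply Rabs_triang]|].
  rewrite !Rabs_mult, (Rabs_pos_eq 2) by lra.
  assert (Rabs b' * Rabs a <= (4 * d) * (2 * d)) by (apply Rmult_le_compat; try apply Rabs_pos; lra).
  assert (Rabs a' * Rabs b <= (2 * d) * (4 * d)) by (apply Rmult_le_compat; try apply Rabs_pos; lra).
  lra.
Qed.

(* The integral of (1 - cutoff e t) exp(izt) over a period. *)
Definition cutoff_coef (e : R) (z : Z) : R :=
  if Z.eq_dec z 0 then 4 * e else e * ramp_kernel (e * IZR z).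

Lemma cutoff_coef_opp (e : R) (z : Z) : cutoff_coef e (- z) = cutoff_coef e z.
Proof.
unfold cutoff_coef; destruct (Z.eq_dec (- z) 0), (Z.eq_dec z 0); try lia; [reflexivity|].
unfold ramp_kernel; rewrite opp_IZR, <- Ropp_mult_distr_r, <- Ropp_mult_distr_r, !cos_neg.
f_equal; f_equal; ring.
Qed.

Lemma cutoff_coef_bound (e : R) (z : Z) : 0 < e -> Rabs (cutoff_coef e z) <= 4 * e.
Proof.
intros He.
assert (K : forall z, (0 <= z)%Z -> Rabs (cutoff_coef e z) <= 4 * e).
{ clear z; intros z Hz; unfold cutoff_coef; destruct (Z.eq_dec z 0).
  - rewrite Rabs_pos_eq; lra.
  - assert (0 < IZR z) by (apply IZR_lt; lia).
    rewrite Rabs_mult, (Rabs_pos_eq e) by lra.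
    pose proof (ramp_kernel_bound (e * IZR z) ltac:(nra)). nra. }
destruct (Z_le_gt_dec 0 z); [apply K; assumption|].
rewrite <- cutoff_coef_opp; apply K; lia.
Qed.

(** An odd, increasing majorant for the variation of [cutoff_coef]. The jump of [8 * e] on either
    side of 0 pays for the separate value of the coefficient at 0; the 96 is the constant of
    [ramp_kernel_increment]. *)
Definition coef_variation (e : R) (z : Z) : R :=
  IZR (Z.sgn z) * (e * (8 + 96 * ((e * Rabs (IZR z)) / (1 + e * Rabs (IZR z))))).

Lemma coef_variation_opp (e : R) (z : Z) : coef_variation e (- z) = - coef_variation e z.
Proof.
unfold coef_variation; rewrite Z.sgn_opp, !opp_IZR, Rabs_Ropp; ring.
Qed.

Lemma coef_variation_bound (e : R) (z : Z) : 0 < e -> Rabs (coef_variation e z) <= 104 * e.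
Proof.
intros He; unfold coef_variation.
pose proof (Rabs_pos (IZR z)).
assert (0 <= e * Rabs (IZR z)) by nra.
set (w := e * Rabs (IZR z) / (1 + e * Rabs (IZR z))).
assert (0 <= w <= 1).
{ unfold w; split; [apply Rdiv_le_0_compat; lra|apply Rle_div_l; lra]. }
rewrite Rabs_mult, (Rabs_pos_eq (e * _)) by nra.
assert (Rabs (IZR (Z.sgn z)) <= 1).
{ destruct z; simpl; unfold Rabs; destruct (Rcase_abs _); lra. }
apply Rle_trans with (1 * (e * (8 + 96 * w))); [apply Rmult_le_compat_r; [nra|lra]|nra].
Qed.

(* The increments are dominated by those of an increasing function bounded by O(e), so their sum
   over all integers is O(e). *)
Lemma cutoff_coef_increment (e : R) (z : Z) : 0 < e ->
  Rabs (cutoff_coef e z - cutoff_coef e (z - 1)) <= coef_variation e z - coef_variation e (z - 1).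
Proof.
intros He.
assert (K : forall z, (1 <= z)%Z ->
  Rabs (cutoff_coef e z - cutoff_coef e (z - 1)) <= coef_variation e z - coef_variation e (z - 1)).
{ clear z; intros z Hz.
  destruct (Z.eq_dec z 1) as [->|Hz1].
  - pose proof (cutoff_coef_bound e 1 He); pose proof (cutoff_coef_bound e (1 - 1) He).
    apply Rle_trans with (8 * e).
    + unfold Rminus at 1; eapply Rle_trans; [apply Rabs_triang|]; rewrite Rabs_Ropp; lra.
    + replace (coef_variation e (1 - 1)) with 0 by (unfold coef_variation; simpl; ring).
      unfold coef_variation; simpl; rewrite Rabs_R1.
      assert (0 <= e * 1 / (1 + e * 1)) by (apply Rdiv_le_0_compat; lra).
      pose proof (Rmult_le_pos e _ ltac:(lra) H1).
      set (w := e * 1 / (1 + e * 1)) in *; clearbody w; nra.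
  - assert (2 <= IZR z) by (apply IZR_le; lia).
    unfold cutoff_coef, coef_variation.
    destruct (Z.eq_dec z 0), (Z.eq_dec (z - 1) 0); try lia.
    rewrite !Z.sgn_pos by lia.
    rewrite minus_IZR, (Rabs_pos_eq (IZR z)), (Rabs_pos_eq (IZR z - 1)) by lra.
    rewrite <- Rmult_minus_distr_l, Rabs_mult, (Rabs_pos_eq e) by lra.
    pose proof (ramp_kernel_increment (e * (IZR z - 1)) (e * IZR z) ltac:(nra) ltac:(nra)). nra. }
destruct (Z_le_gt_dec 1 z); [apply K; assumption|].
(* The reflection z -> 1 - z turns the pair (z, z - 1) into (1 - z, - z). Coefficients are even and
   the majorant is odd, so the case z >= 1 yields the case z <= 0. *)
specialize (K (1 - z)%Z ltac:(lia)).
replace (1 - z - 1)%Z with (- z)%Z in K by ring.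
rewrite cutoff_coef_opp, coef_variation_opp in K.
replace (1 - z)%Z with (- (z - 1))%Z in K by ring.
rewrite cutoff_coef_opp, coef_variation_opp, Rabs_minus_sym in K; lra.
Qed.

(** * Integrals of exponentials against the cutoff *)

Lemma is_derive_expi_primitive {X : CompleteNormedModule C_AbsRing} (s : R) (v : X) (t : R) : s <> 0 ->
  is_derive (V := real_space X)
    (fun t => scal (expi (s * t) : C_AbsRing) (scal (Cmult (RtoC (/ s)) (Copp Ci) : C_AbsRing) v)) t
    (scal (expi (s * t) : C_AbsRing) v).
Proof.
intros Hs.
set (w := scal (Cmult (RtoC (/ s)) (Copp Ci) : C_AbsRing) v).
assert (H := is_derive_expi_scal s (fun _ => w) t zero (is_derive_const (K := R_AbsRing) (V := real_space X) w t)).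
refine (eq_rect _ (is_derive (V := real_space X) _ t) H _ _).
refine (eq_trans (f_equal (plus _) (scal_zero_r (expi (s * t) : C_AbsRing) : _ = (zero : X))) _).
refine (eq_trans (plus_zero_r (G := X) _) _).
unfold w; rewrite <- scal_Cmult; f_equal.
unfold Cmult, Copp, RtoC, Ci, expi; simpl; f_equal; field; exact Hs.
Qed.

Lemma continuous_expi_const {X : CompleteNormedModule C_AbsRing} (s : R) (v : X) (t : R) :
  continuous (U := real_space X) (fun t => scal (expi (s * t) : C_AbsRing) v) t.
Proof.
apply (ex_derive_continuous (K := R_AbsRing) (V := real_space X)); eexists.
exact (is_derive_expi_scal s (fun _ => v) t zero (is_derive_const (K := R_AbsRing) (V := real_space X) v t)).
Qed.

Lemma is_RInt_expi {X : CompleteNormedModule C_AbsRing} (s : R) (v : X) (a b : R) : s <> 0 ->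
  is_RInt (V := real_space X) (fun t => scal (expi (s * t) : C_AbsRing) v) a b
    (scal (Cmult (Cminus (expi (s * b)) (expi (s * a))) (Cmult (RtoC (/ s)) (Copp Ci)) : C_AbsRing) v).
Proof.
intros Hs.
refine (eq_rect _ (is_RInt (V := real_space X) _ _ _) (is_RInt_derive (V := real_space X) _ _ a b _ _) _ _).
- intros t _; exact (is_derive_expi_primitive s v t Hs).
- intros t _; apply continuous_expi_const.
- exact (eq_trans (eq_sym (scal_Cminus _ _ _)) (eq_sym (scal_Cmult _ _ v))).
Qed.

(** Integration by parts reduces the integral to averages of a primitive over the two ramps, which
    are explicit. For nonzero [z] the values of the primitive at [PI] and [- PI] cancel by
    periodicity; for [z = 0] the primitive is [t v] and they produce the [2 * PI]. *)
Lemma is_RInt_cutoff_expi {X : CompleteNormedModule C_AbsRing} (e : R) (z : Z) (v : X) :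
  0 < e -> 3 * e <= PI ->
  is_RInt (V := real_space X)
    (fun t => scal (RtoC (cutoff e t) : C_AbsRing) (scal (expi (IZR z * t) : C_AbsRing) v)) (- PI) PI
    (scal (RtoC ((if Z.eq_dec z 0 then 2 * PI else 0) - cutoff_coef e z) : C_AbsRing) v).
Proof.
intros He HeP; unfold cutoff_coef; destruct (Z.eq_dec z 0) as [->|Hz].
- assert (D : forall t, is_derive (K := R_AbsRing) (V := real_space X)
     (fun t => scal (t : R) (v : real_space X)) t v).
  { intros t.
    refine (eq_rect _ (is_derive (V := real_space X) _ t)
      (is_derive_scal_l (K := R_AbsRing) (V := real_space X) (fun t => t) t 1 v _) _ (scal_one _)).
    exact (is_derive_id (K := R_AbsRing) t). }
  assert (I : forall a b, is_RInt (V := real_space X) (fun t => scal (t : R) (v : real_space X)) a b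
     (scal (b ^ 2 / 2 - a ^ 2 / 2 : R) (v : real_space X))).
  { intros a b.
    refine (eq_rect _ (is_RInt (V := real_space X) _ _ _) (is_RInt_derive (V := real_space X)
      (fun t => scal (t ^ 2 / 2 : R) (v : real_space X)) _ a b _ _) _ _).
    - intros t _.
      apply (is_derive_scal_l (K := R_AbsRing) (V := real_space X) (fun t => t ^ 2 / 2) t t v).
      auto_derive; [trivial|field].
    - intros t _; apply (ex_derive_continuous (K := R_AbsRing) (V := real_space X)); eexists; apply D.
    - exact (eq_sym (scal_minus_distr_r (K := R_AbsRing) (V := real_space X) _ _ _)). }
  assert (H := is_RInt_cutoff_parts (V := real_space X) _ (fun _ => v) e _ _ He HeP (fun t _ => D t)
     (fun t _ => continuous_const (U := R_UniformSpace) (V := real_space X) v t) (I e (3 * e)) (I (- (3 * e)) (- e))).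
  apply (is_RInt_ext (V := real_space X) (fun t => scal (cutoff e t) (v : real_space X))).
  + intros t _; rewrite Rmult_0_l, expi_0.
    exact (f_equal (scal (RtoC (cutoff e t) : C_AbsRing)) (eq_sym (scal_one v))).
  + refine (eq_rect _ (is_RInt (V := real_space X) _ _ _) H _ _).
    change (minus (minus (scal (RtoC PI : C_AbsRing) v) (scal (RtoC (- PI) : C_AbsRing) v))
      (scal (RtoC (/ (2 * e)) : C_AbsRing)
        (minus (scal (RtoC ((3 * e) ^ 2 / 2 - e ^ 2 / 2) : C_AbsRing) v)
           (scal (RtoC ((- e) ^ 2 / 2 - (- (3 * e)) ^ 2 / 2) : C_AbsRing) v)))
      = scal (RtoC (2 * PI - 4 * e) : C_AbsRing) v).
    rewrite <- !scal_Cminus, <- scal_Cmult, <- scal_Cminus; f_equal.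
    unfold Cminus, Cplus, Cmult, Copp, RtoC; simpl; f_equal; field; lra.
- assert (Hs : IZR z <> 0) by (intros E; apply eq_IZR in E; lia).
  set (s := IZR z) in *.
  set (w := scal (Cmult (RtoC (/ s)) (Copp Ci) : C_AbsRing) v).
  assert (H := is_RInt_cutoff_parts (V := real_space X)
     (fun t => scal (expi (s * t) : C_AbsRing) w) (fun t => scal (expi (s * t) : C_AbsRing) v) e _ _ He HeP
     (fun t _ => is_derive_expi_primitive s v t Hs) (fun t _ => continuous_expi_const s v t)
     (is_RInt_expi s w e (3 * e) Hs) (is_RInt_expi s w (- (3 * e)) (- e) Hs)).
  refine (eq_rect _ (is_RInt (V := real_space X) _ _ _) H _ _).
  change (minus (minus (scal (expi (s * PI) : C_AbsRing) w) (scal (expi (s * - PI) : C_AbsRing) w))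
     (scal (RtoC (/ (2 * e)) : C_AbsRing)
       (minus
         (scal (Cmult (Cminus (expi (s * (3 * e))) (expi (s * e))) (Cmult (RtoC (/ s)) (Copp Ci)) : C_AbsRing) w)
         (scal (Cmult (Cminus (expi (s * - e)) (expi (s * - (3 * e)))) (Cmult (RtoC (/ s)) (Copp Ci)) : C_AbsRing) w)))
    = scal (RtoC (0 - e * ramp_kernel (e * s)) : C_AbsRing) v).
  rewrite <- !scal_Cminus, <- scal_Cmult, <- scal_Cminus; unfold w; rewrite <- scal_Cmult; f_equal.
  assert (S0 : sin (s * PI) = 0) by (apply sin_eq_0_1; exists z; reflexivity).
  rewrite <- !Ropp_mult_distr_r.
  unfold ramp_kernel, expi, Cminus, Cplus, Cmult, Copp, RtoC, Ci; simpl.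
  rewrite !cos_neg, !sin_neg, S0, (Rmult_comm e s).
  replace (3 * (s * e)) with (s * (3 * e)) by ring.
  f_equal; field; lra.
Qed.

(** Summation by parts. With the boundary term subtracted, passing from [N] to [S N] adds exactly
    [q N - q (S N)] times the partial sum up to [N], so the bounds telescope through [W]. *)
Lemma abel_bound {X : CompleteNormedModule C_AbsRing} (q W : nat -> R) (x : nat -> X) (B : R) (N : nat) :
  0 <= B -> (forall k, norm (sum_n x k) <= B) ->
  (forall k, Rabs (q k - q (S k)) <= W k - W (S k)) ->
  norm (minus (sum_n (fun k => scal (RtoC (q k) : C_AbsRing) (x k)) N)
              (scal (RtoC (q N) : C_AbsRing) (sum_n x N))) <= B * (W O - W N).
Proof.
intros HB Hs HW; induction N as [|N IH].
- rewrite !sum_O, Rminus_diag.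
  rewrite Rmult_0_r; apply Req_le; exact (eq_trans (f_equal norm (minus_eq_zero _)) (norm_zero (V := X))).
- set (u := sum_n (fun k => scal (RtoC (q k) : C_AbsRing) (x k)) N) in *.
  set (s := sum_n x N) in *.
  assert (E : minus (sum_n (fun k => scal (RtoC (q k) : C_AbsRing) (x k)) (S N))
              (scal (RtoC (q (S N)) : C_AbsRing) (sum_n x (S N)))
    = plus (minus u (scal (RtoC (q N) : C_AbsRing) s)) (scal (RtoC (q N - q (S N)) : C_AbsRing) s)).
  { rewrite !sum_Sn; fold u s.
    replace (RtoC (q N - q (S N))) with (Cminus (RtoC (q N)) (RtoC (q (S N)))) by
      (symmetry; apply RtoC_minus).
    rewrite scal_Cminus.
    refine (eq_trans _ (minus_trans (G := X) _ _ _)).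
    refine (eq_trans (f_equal (minus _) (scal_distr_l _ s (x (S N)))) _).
    generalize (scal (RtoC (q (S N)) : C_AbsRing) (x (S N))) (scal (RtoC (q (S N)) : C_AbsRing) s); intros a b.
    rewrite !(minusE (G := X)), (opp_plus (G := X)), (plus_comm (opp b)).
    refine (eq_trans (eq_sym (plus_assoc (G := X) u a _)) _); f_equal.
    refine (eq_trans (plus_assoc (G := X) a _ _) _).
    exact (eq_trans (f_equal (fun c => plus c (opp b)) (plus_opp_r (G := X) a)) (plus_zero_l (G := X) _)). }
  rewrite E.
  eapply Rle_trans; [exact (norm_triangle (V := X) _ _)|].
  eapply Rle_trans; [apply Rplus_le_compat; [exact IH|apply norm_scal_Cmod]|].
  rewrite Cmod_R.
  specialize (HW N); specialize (Hs N); fold s in Hs.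
  pose proof (Rabs_pos (q N - q (S N))); pose proof (norm_ge_0 s).
  assert (Rabs (q N - q (S N)) * norm s <= (W N - W (S N)) * B) by (apply Rmult_le_compat; assumption).
  lra.
Qed.

Lemma low_sum_bound {X : CompleteNormedModule C_AbsRing} (x : nat -> X) (B e rho : R) (n N : nat) :
  0 < e -> 0 < rho < 1 -> 0 <= B -> (forall k, norm (sum_n x k) <= B) ->
  norm (sum_n (fun k => scal (RtoC (rho ^ S k * cutoff_coef e (Z.of_nat n - Z.of_nat k)) : C_AbsRing) (x k)) N)
  <= 216 * e * B.
Proof.
intros He Hr HB Hs.
set (q := fun k => rho ^ S k * cutoff_coef e (Z.of_nat n - Z.of_nat k)).
(* As [k] grows [n - k] falls, so the first term decreases with [k]. The second absorbs the
   variation of the radial factor [rho ^ S k], weighted by the bound [4 * e] on the coefficients;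
   this keeps the estimate uniform in [rho]. *)
set (W := fun k => coef_variation e (Z.of_nat n - Z.of_nat k) + 4 * e * rho ^ S k).
assert (P : forall k, 0 <= rho ^ k <= 1).
{ intros k; split; [apply pow_le; lra|].
  rewrite <- (pow1 k); apply pow_incr; lra. }
assert (A := abel_bound q W x B N HB Hs).
assert (A1 : norm (minus (sum_n (fun k => scal (RtoC (q k) : C_AbsRing) (x k)) N)
              (scal (RtoC (q N) : C_AbsRing) (sum_n x N))) <= B * (W O - W N)).
{ apply A; intros k; unfold q, W.
  replace (Z.of_nat n - Z.of_nat (S k))%Z with (Z.of_nat n - Z.of_nat k - 1)%Z by lia.
  set (z := (Z.of_nat n - Z.of_nat k)%Z).
  assert (H1 := cutoff_coef_increment e z He).
  assert (H2 := cutoff_coef_bound e (z - 1) He).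
  replace (rho ^ S k * cutoff_coef e z - rho ^ S (S k) * cutoff_coef e (z - 1))
    with (rho ^ S k * (cutoff_coef e z - cutoff_coef e (z - 1))
      + (rho ^ S k * (1 - rho)) * cutoff_coef e (z - 1)) by (simpl; ring).
  eapply Rle_trans; [apply Rabs_triang|].
  pose proof (P (S k)).
  rewrite !Rabs_mult, (Rabs_pos_eq (rho ^ S k)), (Rabs_pos_eq (1 - rho)) by lra.
  assert (rho ^ S k * (1 - rho) * Rabs (cutoff_coef e (z - 1)) <= rho ^ S k * (1 - rho) * (4 * e)).
  { apply Rmult_le_compat_l; [apply Rmult_le_pos; lra|exact H2]. }
  assert (rho ^ S k * Rabs (cutoff_coef e z - cutoff_coef e (z - 1))
     <= 1 * (coef_variation e z - coef_variation e (z - 1))).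
  { apply Rmult_le_compat; [lra|apply Rabs_pos|lra|exact H1]. }
  replace (rho ^ S (S k)) with (rho * rho ^ S k) by reflexivity.
  lra. }
assert (A2 : norm (scal (RtoC (q N) : C_AbsRing) (sum_n x N)) <= 4 * e * B).
{ eapply Rle_trans; [apply norm_scal_Cmod|]; rewrite Cmod_R.
  apply Rmult_le_compat; [apply Rabs_pos|apply norm_ge_0| |apply Hs].
  unfold q; rewrite Rabs_mult.
  pose proof (P (S N)); rewrite (Rabs_pos_eq (rho ^ S N)) by lra.
  pose proof (cutoff_coef_bound e (Z.of_nat n - Z.of_nat N) He).
  pose proof (Rabs_pos (cutoff_coef e (Z.of_nat n - Z.of_nat N))). nra. }
(* 212 = 104 + 104 + 4, from the two values of [coef_variation] and the radial term; the boundary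
   term [A2] brings the total to 216. *)
assert (A3 : W O - W N <= 212 * e).
{ unfold W.
  pose proof (coef_variation_bound e (Z.of_nat n - Z.of_nat 0) He) as V1.
  pose proof (coef_variation_bound e (Z.of_nat n - Z.of_nat N) He) as V2.
  apply Rabs_le_between in V1. apply Rabs_le_between in V2.
  pose proof (P 1%nat); pose proof (P (S N)).
  assert (4 * e * rho ^ 1 <= 4 * e * 1) by (apply Rmult_le_compat_l; lra).
  assert (0 <= 4 * e * rho ^ S N) by (apply Rmult_le_pos; lra).
  lra. }
set (u := sum_n (fun k => scal (RtoC (q k) : C_AbsRing) (x k)) N) in *.
set (w := scal (RtoC (q N) : C_AbsRing) (sum_n x N)) in *.
assert (T := norm_triangle_inv (V := X) u w).
pose proof (Rle_abs (norm u - norm w)).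
assert (B * (W O - W N) <= B * (212 * e)) by (apply Rmult_le_compat_l; assumption).
change (norm u - norm w <= Rabs (norm u - norm w)) in H.
change (Rabs (norm u - norm w) <= norm (minus u w)) in T.
change (norm u <= 216 * e * B).
lra.
Qed.

(** * Low frequencies *)

Lemma sum_n_minus {G : AbelianGroup} (u v : nat -> G) (N : nat) :
  sum_n (fun k => minus (u k) (v k)) N = minus (sum_n u N) (sum_n v N).
Proof.
induction N as [|N IH].
- rewrite !sum_O; reflexivity.
- rewrite !sum_Sn, IH, !minusE, opp_plus, <- !plus_assoc; f_equal.
  rewrite !plus_assoc; f_equal; apply plus_comm.
Qed.

Lemma sum_n_single {G : AbelianMonoid} (u : nat -> G) (n N : nat) :
  (n <= N)%nat -> (forall k, k <> n -> u k = zero) -> sum_n u N = u n.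
Proof.
intros HnN Hu.
assert (Z : forall M, (M < n)%nat -> sum_n u M = zero).
{ induction M as [|M IH]; intros HM.
  - rewrite sum_O; apply Hu; lia.
  - rewrite sum_Sn, IH, Hu by lia; apply plus_zero_l. }
induction N as [|N IH].
- rewrite sum_O; f_equal; lia.
- rewrite sum_Sn; destruct (Nat.eq_dec n (S N)) as [->|HN].
  + rewrite Z by lia; apply plus_zero_l.
  + rewrite IH, (Hu (S N)) by lia; apply plus_zero_r.
Qed.

Lemma is_RInt_sum_n {V : NormedModule R_AbsRing} (f : nat -> R -> V) (a b : R) (l : nat -> V) (N : nat) :
  (forall k, is_RInt (f k) a b (l k)) ->
  is_RInt (fun t => sum_n (fun k => f k t) N) a b (sum_n l N).
Proof.
intros H; induction N as [|N IH].
- rewrite sum_O; apply (is_RInt_ext (f O)); [intros; symmetry; apply sum_O|apply H].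
- rewrite sum_Sn.
  apply (is_RInt_ext (fun t => plus (sum_n (fun k => f k t) N) (f (S N) t))).
  + intros; symmetry; apply sum_Sn.
  + apply is_RInt_plus; [exact IH|apply H].
Qed.

Lemma filterlim_norm_minus {T : Type} {K : AbsRing} {V : NormedModule K} {F : (T -> Prop) -> Prop}
  {FF : Filter F} (f : T -> V) (l y : V) :
  filterlim f F (locally l) -> filterlim (fun t => norm (minus (f t) y)) F (locally (norm (minus l y))).
Proof.
intros Hf.
apply (filterlim_comp _ _ _ (fun t => plus (f t) (opp y)) norm _ (locally (plus l (opp y))));
  [|apply filterlim_norm].
apply (filterlim_comp_2 (G := locally l) (H := locally (opp y)) f (fun _ => opp y) plus);
  [exact Hf|apply filterlim_const|apply filterlim_plus].
Qed.

(** The tail is compared with that of the majorant at finite stages, then in the limit. The bound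
    involves only [b], hence is uniform in any parameter on which [a] depends. *)
Lemma series_remainder_le {K : AbsRing} {V : NormedModule K} (a : nat -> V) (b : nat -> R) (la : V) (lb : R) (N : nat) :
  (forall k, norm (a k) <= b k) -> is_series a la -> is_series b lb ->
  norm (minus la (sum_n a N)) <= lb - sum_n b N.
Proof.
intros Hab Ha Hb.
assert (F : forall M, (N <= M)%nat -> norm (minus (sum_n a M) (sum_n a N)) <= sum_n b M - sum_n b N).
{ induction 1 as [|M HM IH].
  - rewrite Rminus_diag; apply Req_le; rewrite minus_eq_zero; apply norm_zero.
  - rewrite !sum_Sn.
    apply Rle_trans with (norm (minus (sum_n a M) (sum_n a N)) + norm (a (S M))).
    + eapply Rle_trans; [|apply norm_triangle]; apply Req_le; f_equal.
      rewrite !(minusE (G := V)), <- !plus_assoc; f_equal; apply plus_comm.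
    + specialize (Hab (S M)); change (plus (sum_n b M) (b (S M))) with (sum_n b M + b (S M)); lra. }
assert (L1 : is_lim_seq (fun M => norm (minus (sum_n a M) (sum_n a N))) (norm (minus la (sum_n a N)))).
{ exact (filterlim_norm_minus _ _ _ Ha). }
assert (L2 : is_lim_seq (fun M => sum_n b M - sum_n b N) (lb - sum_n b N)).
{ apply is_lim_seq_minus'; [exact Hb|apply is_lim_seq_const]. }
exact (is_lim_seq_le_loc _ _ (norm (minus la (sum_n a N))) (lb - sum_n b N) (ex_intro _ N F) L1 L2).
Qed.

Lemma is_series_Gseries {X : CompleteNormedModule C_AbsRing} (x : nat -> X) (D : R) (lam : C) :
  (forall k, norm (x k) <= D) -> 1 < Cmod lam ->
  is_series (fun k => scal (Cinv (Cpow lam (S k)) : C_AbsRing) (x k)) (Gseries x lam).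
Proof.
intros HD Hl; unfold Gseries; apply iota_correct.
assert (Hrho : 0 < / Cmod lam < 1).
{ split; [apply Rinv_0_lt_compat; lra|rewrite <- Rinv_1; apply Rinv_lt_contravar; lra]. }
assert (E : ex_series (fun k => scal (Cinv (Cpow lam (S k)) : C_AbsRing) (x k))).
{ apply (ex_series_le (K := C_AbsRing) (V := X) _ (fun k => D * / Cmod lam ^ S k)).
  - intros k; eapply Rle_trans; [apply norm_scal_Cmod|].
    assert (Hz : Cpow lam (S k) <> 0) by (apply Cpow_nz, Cmod_gt_0; lra).
    rewrite Cmod_inv, Cmod_pow by exact Hz.
    rewrite Rmult_comm; apply Rmult_le_compat_r; [|apply HD].
    left; apply Rinv_0_lt_compat, pow_lt; lra.
  - apply (ex_series_ext (fun k => scal (D * / Cmod lam) ((/ Cmod lam) ^ k))).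
    + intros k; rewrite <- pow_inv; change (D * / Cmod lam * (/ Cmod lam) ^ k = D * (/ Cmod lam) ^ S k).
      simpl; ring.
    + apply (ex_series_scal (V := R_NormedModule)), ex_series_geom; rewrite Rabs_pos_eq; lra. }
destruct E as [l Hl'].
exists l; split; [exact Hl'|]; intros l' H'.
exact (filterlim_locally_unique (V := X) _ _ _ Hl' H').
Qed.

(** The frequency is [S n] because [x n] is the coefficient of the power -(n + 1) in the series. *)
Definition test_function (e : R) (n : nat) (t : R) : C :=
  Cmult (RtoC (cutoff e t)) (expi (INR (S n) * t)).

Lemma Cmod_test_function (e : R) (n : nat) (t : R) : Cmod (test_function e n t) <= 1.
Proof.
unfold test_function; rewrite Cmod_mult, Cmod_expi, Cmod_R.
pose proof (cutoff_bounds e t); rewrite Rabs_pos_eq; lra.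
Qed.

(* Termwise integration of the Laurent series: only the n-th term survives, up to the Fourier
   coefficients of 1 - cutoff, which pair with x by Abel summation. *)
Lemma low_frequency {X : CompleteNormedModule C_AbsRing} (x : nat -> X) (D B e r : R) (n : nat) :
  0 < e -> 3 * e <= PI -> 1 < r -> 0 <= B ->
  (forall k, norm (x k) <= D) -> (forall k, norm (sum_n x k) <= B) ->
  norm (minus
    (RInt (V := real_space X) (fun t => scal (test_function e n t : C_AbsRing)
       (Gseries x (Cmult (RtoC r) (expi t)))) (- PI) PI : X)
    (scal (RtoC (2 * PI * (/ r) ^ S n) : C_AbsRing) (x n))) <= 216 * e * B.
Proof.
intros He HeP Hr HB HD Hs.
set (rho := / r).
assert (Hrho : 0 < rho < 1).
{ unfold rho; split; [apply Rinv_0_lt_compat; lra|rewrite <- Rinv_1; apply Rinv_lt_contravar; lra]. }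
set (lam := fun t => Cmult (RtoC r) (expi t)).
assert (Hlam : forall t, Cmod (lam t) = r).
{ intros t; unfold lam; rewrite Cmod_mult, Cmod_expi, Cmod_R, Rabs_pos_eq; lra. }
set (g := fun k t => scal (Cinv (Cpow (lam t) (S k)) : C_AbsRing) (x k)).
set (c := fun k => scal (RtoC ((if Z.eq_dec (Z.of_nat n - Z.of_nat k) 0 then 2 * PI else 0)
           - cutoff_coef e (Z.of_nat n - Z.of_nat k)) : C_AbsRing) (scal (RtoC (rho ^ S k) : C_AbsRing) (x k))).
assert (I1 : forall k, is_RInt (V := real_space X) (fun t => scal (test_function e n t : C_AbsRing) (g k t))
   (- PI) PI (c k)).
{ intros k; unfold c.
  refine (is_RInt_ext (V := real_space X) _ _ _ _ _ _ (is_RInt_cutoff_expi e _ _ He HeP)).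
  intros t _; unfold g, test_function, lam.
  rewrite <- !scal_Cmult; f_equal.
  assert (Ek : Cinv (Cpow (Cmult (RtoC r) (expi t)) (S k)) = Cmult (RtoC (rho ^ S k)) (expi (- (INR (S k) * t)))).
  { rewrite Cpow_mult_l, Cpow_expi, <- RtoC_pow, <- Cinv_expi.
    unfold rho; rewrite pow_inv, RtoC_inv by (apply pow_nonzero; lra).
    field; split.
    - apply Cmod_gt_0; rewrite Cmod_expi; lra.
    - intros E; apply RtoC_inj in E; revert E; apply pow_nonzero; lra. }
  rewrite Ek.
  replace (IZR (Z.of_nat n - Z.of_nat k) * t) with (INR (S n) * t + - (INR (S k) * t)).
  - rewrite expi_plus; ring.
  - rewrite minus_IZR, <- !INR_IZR_INZ, !S_INR; ring. }
assert (I2 := fun N => is_RInt_sum_n (V := real_space X) _ _ _ _ N I1).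
(* A geometric majorant free of [t]: the series converges uniformly on the circle of radius [r],
   which justifies termwise integration. *)
set (b := fun k => D * rho * rho ^ k).
assert (Sb : is_series b (D * rho * / (1 - rho))).
{ apply (is_series_scal (V := R_NormedModule) (D * rho)), is_series_geom; rewrite Rabs_pos_eq; lra. }
assert (Hgb : forall t k, norm (g k t) <= b k).
{ intros t k; unfold g, b; eapply Rle_trans; [apply norm_scal_Cmod|].
  assert (Hz : Cpow (lam t) (S k) <> 0) by (apply Cpow_nz, Cmod_gt_0; rewrite Hlam; lra).
  rewrite Cmod_inv, Cmod_pow, Hlam by exact Hz.
  rewrite <- pow_inv; fold rho.
  replace (D * rho * rho ^ k) with (rho ^ S k * D) by (simpl; ring).
  apply Rmult_le_compat_l; [apply pow_le; lra|apply HD]. }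
assert (U : filterlim (fun N t => sum_n (fun k => scal (test_function e n t : C_AbsRing) (g k t)) N) eventually
   (locally (T := fct_UniformSpace R (real_space X))
      (fun t => scal (test_function e n t : C_AbsRing) (Gseries x (lam t))))).
{ apply (filterlim_locally (U := fct_UniformSpace R (real_space X))); intros eps.
  assert (Lb : is_lim_seq (fun N => D * rho * / (1 - rho) - sum_n b N)
     (D * rho * / (1 - rho) - D * rho * / (1 - rho))).
  { apply is_lim_seq_minus'; [apply is_lim_seq_const|exact Sb]. }
  rewrite Rminus_diag in Lb.
  apply (filter_imp (fun N => Rabs (D * rho * / (1 - rho) - sum_n b N - 0) < eps)).
  2: exact (Lb _ (locally_ball (0 : R) eps)).
  intros N HN t.
  apply (norm_compat1 (V := X)).
  assert (R1 := series_remainder_le (V := X) (fun k => g k t) b _ _ N (Hgb t)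
    (is_series_Gseries x D (lam t) HD ltac:(rewrite Hlam; exact Hr)) Sb).
  set (z := test_function e n t : C).
  assert (E : sum_n (fun k => scal (z : C_AbsRing) (g k t)) N = scal (z : C_AbsRing) (sum_n (fun k => g k t) N))
    by exact (sum_n_scal_l (V := X) _ _ N).
  assert (Ez : minus (scal (z : C_AbsRing) (sum_n (fun k => g k t) N)) (scal (z : C_AbsRing) (Gseries x (lam t)))
     = scal (z : C_AbsRing) (opp (minus (Gseries x (lam t)) (sum_n (fun k => g k t) N)))).
  { rewrite <- (scal_Cminus_r z); f_equal; exact (eq_sym (opp_minus (G := X) _ _)). }
  apply Rle_lt_trans with (norm (minus (Gseries x (lam t)) (sum_n (fun k => g k t) N))).
  - rewrite E.
    eapply Rle_trans; [apply Req_le; exact (f_equal norm Ez)|].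
    eapply Rle_trans; [apply norm_scal_Cmod|].
    eapply Rle_trans; [apply Rmult_le_compat_r; [apply norm_ge_0|apply Cmod_test_function]|].
    rewrite Rmult_1_l; apply Req_le; exact (norm_opp (V := X) _).
  - rewrite Rminus_0_r in HN.
    eapply Rle_lt_trans; [exact R1|]. eapply Rle_lt_trans; [apply Rle_abs|exact HN]. }
destruct (filterlim_RInt (V := real_space X) _ (- PI) PI eventually _ _ _ I2 U) as [J [L HJ]].
set (y := scal (RtoC (2 * PI * rho ^ S n) : C_AbsRing) (x n)).
enough (Goal : norm (minus (J : X) y) <= 216 * e * B).
{ pose proof (is_RInt_unique (V := real_space X) _ _ _ _ HJ) as <-; exact Goal. }
assert (L' : is_lim_seq (fun N => norm (minus (sum_n c N) y)) (norm (minus (J : X) y))).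
{ exact (filterlim_norm_minus (V := X) _ _ _ L). }
refine (is_lim_seq_le_loc _ _ (norm (minus (J : X) y)) (216 * e * B) _ L' (is_lim_seq_const _)).
exists n; intros N HN.
(* Once [N] reaches [n], the Kronecker part of [c] sums to exactly [y]; what is left is the sum
   treated by Abel summation. *)
assert (Ec : sum_n c N = minus y
   (sum_n (fun k => scal (RtoC (rho ^ S k * cutoff_coef e (Z.of_nat n - Z.of_nat k)) : C_AbsRing) (x k)) N)).
{ set (u := fun k => scal (RtoC ((if Z.eq_dec (Z.of_nat n - Z.of_nat k) 0 then 2 * PI else 0) * rho ^ S k) : C_AbsRing) (x k)).
  assert (Hu : sum_n u N = y).
  { rewrite (sum_n_single u n N HN).
    - unfold u, y; destruct (Z.eq_dec _ 0); [reflexivity|lia].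
    - intros k Hk; unfold u; destruct (Z.eq_dec _ 0); [lia|].
      rewrite Rmult_0_l; exact (scal_zero_l (x k)). }
  rewrite <- Hu.
  refine (eq_trans _ (sum_n_minus (G := X) _ _ N)).
  apply sum_n_ext; intros k; unfold c, u.
  rewrite <- scal_Cmult, <- (scal_Cminus _ _ (x k)); f_equal.
  rewrite <- RtoC_mult, <- RtoC_minus; f_equal; ring. }
rewrite Ec.
assert (Em : forall w : X, norm (minus (minus y w) y) = norm w).
{ intros w; rewrite <- (norm_opp w); f_equal.
  exact (minus_plus_l (G := X) y (opp w)). }
eapply Rle_trans; [apply Req_le, Em|].
apply low_sum_bound; assumption.
Qed.

(** * High frequencies *)

(** Around a point with [|t| < e] the integrand is identically zero, so it is continuous on the
    whole period even where [q] is uncontrolled, in particular at [t = 0]. *)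
Lemma ex_RInt_cutoff {V : CompleteNormedModule R_AbsRing} (q : R -> V) (e : R) :
  0 < e -> (forall t, e <= Rabs t <= PI -> continuous q t) ->
  ex_RInt (fun t => scal (cutoff e t) (q t)) (- PI) PI.
Proof.
intros He Hq; pose proof PI_RGT_0.
apply (ex_RInt_continuous (V := V)); rewrite Rmin_left, Rmax_right by lra; intros t Ht.
destruct (Rle_dec e (Rabs t)) as [Het|Het].
- apply (continuous_scal (V := V)); [apply continuous_cutoff; exact He|].
  apply Hq; split; [exact Het|apply Rabs_le; exact Ht].
- apply (continuous_ext_loc (T := R_UniformSpace) (U := V) (fun t => scal (cutoff e t) (q t)) (fun _ => zero)); [|apply continuous_const].
  assert (Hd : 0 < e - Rabs t) by lra.
  exists (mkposreal _ Hd); intros y Hy.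
  change (Rabs (y - t) < e - Rabs t) in Hy.
  rewrite cutoff_near; [symmetry; apply (scal_zero_l (q y))|exact He|].
  pose proof (Rabs_triang_inv y t); lra.
Qed.

Lemma expi_INR_PI (k : nat) : expi (INR k * PI) = expi (INR k * - PI).
Proof.
assert (S0 : sin (INR k * PI) = 0).
{ apply sin_eq_0_1; exists (Z.of_nat k); rewrite <- INR_IZR_INZ; reflexivity. }
rewrite <- Ropp_mult_distr_r; unfold expi; rewrite cos_neg, sin_neg, S0, Ropp_0; reflexivity.
Qed.

Lemma expi_PI_opp : expi PI = expi (- PI).
Proof. pose proof (expi_INR_PI 1) as H; simpl in H; rewrite !Rmult_1_l in H; exact H. Qed.

(** Differentiating the [j]-th derivative along [expi t] produces a factor [expi t]. Letting the
    frequency grow with [j] absorbs it, so integration by parts maps [wave] at [j] to [wave] at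
    [S j] as a single term, with no combinatorial sums; all frequencies stay above [n]. *)
Definition wave {X : CompleteNormedModule C_AbsRing} (F : C -> X) (n j : nat) (t : R) : X :=
  scal (expi (INR (S n + j) * t) : C_AbsRing) (circle_derive_n F j (expi t)).

Definition wave_integral {X : CompleteNormedModule C_AbsRing} (F : C -> X) (e : R) (n j : nat) : X :=
  RInt (V := real_space X) (fun t => scal (RtoC (cutoff e t) : C_AbsRing) (wave F n j t)) (- PI) PI.

Lemma is_derive_wave {X : CompleteNormedModule C_AbsRing} (F : C -> X) (n j : nat) (t : R) :
  smooth_punctured_circle F -> 0 < Rabs t <= PI ->
  is_derive (V := real_space X)
    (fun t => scal (Cmult (RtoC (/ INR (S n + j))) (Copp Ci) : C_AbsRing) (wave F n j t)) t
    (plus (wave F n j t) (scal (RtoC (/ INR (S n + j)) : C_AbsRing) (wave F n (S j) t))).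
Proof.
intros HF Ht.
assert (H := is_derive_scal_C (Cmult (RtoC (/ INR (S n + j))) (Copp Ci)) _ _ _
  (is_derive_expi_scal (INR (S n + j)) _ t _ (is_derive_circle_derive_n F j t HF Ht))).
refine (eq_rect _ (is_derive (V := real_space X) _ t) H _ _).
refine (eq_trans (scal_Cplus_r (X := X) _ _ _) _).
unfold wave; rewrite <- !scal_Cmult.
assert (Hn : INR (S n + j) <> 0) by (apply not_0_INR; lia).
replace (INR (S n + S j)) with (INR (S n + j) + 1)
  by (rewrite <- S_INR; f_equal; lia).
f_equal.
- f_equal; unfold Cmult, Copp, RtoC, Ci, expi; simpl; f_equal; field; exact Hn.
- f_equal; rewrite Rmult_plus_distr_r, Rmult_1_l, expi_plus.
  unfold Cmult, Copp, RtoC, Ci, expi; simpl; f_equal; ring.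
Qed.

Lemma continuous_wave {X : CompleteNormedModule C_AbsRing} (F : C -> X) (n j : nat) (t : R) :
  smooth_punctured_circle F -> 0 < Rabs t <= PI ->
  continuous (U := real_space X) (wave F n j) t.
Proof.
intros HF Ht; apply (ex_derive_continuous (K := R_AbsRing) (V := real_space X)); eexists.
exact (is_derive_expi_scal (INR (S n + j)) _ t _ (is_derive_circle_derive_n F j t HF Ht)).
Qed.

Lemma is_RInt_wave {X : CompleteNormedModule C_AbsRing} (F : C -> X) (e : R) (n j : nat) :
  smooth_punctured_circle F -> 0 < e ->
  is_RInt (V := real_space X) (fun t => scal (RtoC (cutoff e t) : C_AbsRing) (wave F n j t)) (- PI) PI
    (wave_integral F e n j).
Proof.
intros HF He; apply (RInt_correct (V := real_space X)).
apply (ex_RInt_cutoff (V := real_space X)); [exact He|].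
intros t Ht; apply continuous_wave; [exact HF|lra].
Qed.

Lemma wave_integral_bound {X : CompleteNormedModule C_AbsRing} (F : C -> X) (e A : R) (n j : nat) :
  smooth_punctured_circle F -> 0 < e -> 0 <= A ->
  (forall t, e <= Rabs t <= PI -> norm (circle_derive_n F j (expi t)) <= A) ->
  norm (wave_integral F e n j) <= 2 * PI * A.
Proof.
intros HF He HA Hb; pose proof PI_RGT_0.
replace (2 * PI) with (PI - - PI) by ring.
refine (norm_RInt_le_const (V := real_space X) _ _ _ _ A _ _ (is_RInt_wave F e n j HF He)); [lra|].
intros t Ht.
change (norm (scal (RtoC (cutoff e t) : C_AbsRing) (wave F n j t)) <= A).
eapply Rle_trans; [apply norm_scal_Cmod|].
rewrite Cmod_R; pose proof (cutoff_bounds e t); rewrite Rabs_pos_eq by lra.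
destruct (Rle_dec e (Rabs t)) as [Het|Het].
- assert (norm (wave F n j t) <= A).
  { eapply Rle_trans; [apply norm_scal_expi|apply Hb]; split; [exact Het|apply Rabs_le; exact Ht]. }
  pose proof (norm_ge_0 (wave F n j t)). nra.
- rewrite cutoff_near by lra; lra.
Qed.

(** Each ramp has length [2 * e] and weight [1 / (2 * e)], so it contributes at most [A / nu] with
    no trace of [e]; the two ramps give [2 * A]. The term in which the cutoff is not differentiated
    is the next integral. *)
Lemma wave_integral_step {X : CompleteNormedModule C_AbsRing} (F : C -> X) (e A : R) (n j : nat) :
  smooth_punctured_circle F -> 0 < e -> 3 * e <= PI -> (0 < n)%nat -> 0 <= A ->
  (forall t, e <= Rabs t <= 3 * e -> norm (circle_derive_n F j (expi t)) <= A) ->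
  norm (wave_integral F e n j) <= (2 * A + norm (wave_integral F e n (S j))) / INR n.
Proof.
intros HF He HeP Hn HA Hb.
assert (Hn0 : 0 < INR n) by (apply lt_0_INR; exact Hn).
assert (Hnu : INR n <= INR (S n + j)) by (apply le_INR; lia).
set (nu := INR (S n + j)) in *.
set (k := Cmult (RtoC (/ nu)) (Copp Ci)).
assert (Hk : Cmod k = / nu).
{ unfold k; rewrite Cmod_mult, Cmod_opp, Cmod_R, Rabs_pos_eq by (left; apply Rinv_0_lt_compat; lra).
  rewrite Cmod_Ci; ring. }
set (Q := fun t => scal (k : C_AbsRing) (wave F n j t)).
assert (CQ : forall a b, (forall t, a <= t <= b -> e <= Rabs t <= 3 * e) -> a <= b -> b - a = 2 * e ->
  exists I : X, is_RInt (V := real_space X) Q a b I /\ norm I <= 2 * e * (A / nu)).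
{ intros a b Hab Hle Hba.
  assert (E : ex_RInt (V := real_space X) Q a b).
  { apply (ex_RInt_continuous (V := real_space X)); rewrite Rmin_left, Rmax_right by exact Hle.
    intros t Ht; apply (ex_derive_continuous (K := R_AbsRing) (V := real_space X)); eexists.
    apply is_derive_wave; [exact HF|]; specialize (Hab t Ht); lra. }
  destruct E as [I HI]; exists I; split; [exact HI|].
  rewrite <- Hba.
  refine (norm_RInt_le_const (V := real_space X) _ _ _ _ _ Hle _ HI).
  intros t Ht; change (norm (scal (k : C_AbsRing) (wave F n j t)) <= A / nu).
  eapply Rle_trans; [apply norm_scal_Cmod|]; rewrite Hk, Rmult_comm.
  apply Rmult_le_compat_r; [left; apply Rinv_0_lt_compat; lra|].
  eapply Rle_trans; [apply norm_scal_expi|apply Hb, Hab, Ht]. }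
destruct (CQ e (3 * e)) as [I1 [HI1 B1]]; [|lra|ring|].
{ intros t Ht; rewrite Rabs_pos_eq; lra. }
destruct (CQ (- (3 * e)) (- e)) as [I2 [HI2 B2]]; [|lra|ring|].
{ intros t Ht; rewrite Rabs_left; lra. }
assert (Hq1 : forall t, e <= Rabs t <= PI ->
   continuous (U := real_space X) (fun t => plus (wave F n j t) (scal (RtoC (/ nu) : C_AbsRing) (wave F n (S j) t))) t).
{ intros t Ht.
  apply (continuous_plus (V := real_space X)); [apply continuous_wave; [exact HF|lra]|].
  apply (continuous_scal_r (V := real_space X)); apply continuous_wave; [exact HF|lra]. }
assert (P := is_RInt_cutoff_parts (V := real_space X) Q _ e I1 I2 He HeP
  (fun t Ht => is_derive_wave F n j t HF ltac:(lra)) Hq1 HI1 HI2).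
set (J := wave_integral F e n j); set (J' := wave_integral F e n (S j)).
assert (P' : is_RInt (V := real_space X)
  (fun t => scal (RtoC (cutoff e t) : C_AbsRing) (plus (wave F n j t) (scal (RtoC (/ nu) : C_AbsRing) (wave F n (S j) t))))
  (- PI) PI (plus J (scal (RtoC (/ nu) : C_AbsRing) J'))).
{ refine (is_RInt_ext (V := real_space X) _ _ _ _ _ _
    (is_RInt_plus (V := real_space X) _ _ _ _ _ _ (is_RInt_wave F e n j HF He)
      (is_RInt_scal (V := real_space X) _ _ _ (/ nu) _ (is_RInt_wave F e n (S j) HF He)))).
  intros t _.
  refine (eq_trans _ (eq_sym (scal_Cplus_r (X := X) _ _ _))).
  refine (f_equal (plus _) _).
  change (scal (RtoC (/ nu) : C_AbsRing) (scal (RtoC (cutoff e t) : C_AbsRing) (wave F n (S j) t))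
    = scal (RtoC (cutoff e t) : C_AbsRing) (scal (RtoC (/ nu) : C_AbsRing) (wave F n (S j) t))).
  rewrite <- !scal_Cmult; f_equal; ring. }
(* The frequency is an integer, so [Q] takes equal values at both ends of the period. *)
assert (HQ : minus (Q PI) (Q (- PI)) = zero).
{ unfold Q, wave; rewrite expi_INR_PI, expi_PI_opp; apply minus_eq_zero. }
assert (E : plus J (scal (RtoC (/ nu) : C_AbsRing) J')
   = opp (scal (RtoC (/ (2 * e)) : C_AbsRing) (minus I1 I2))).
{ refine (eq_trans (eq_sym (is_RInt_unique (V := real_space X) _ _ _ _ P')) _).
  refine (eq_trans (is_RInt_unique (V := real_space X) _ _ _ _ P) _).
  refine (eq_trans (f_equal (fun y : X => minus y _) HQ) _).
  exact (plus_zero_l (G := X) _). }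
assert (N0 : norm (minus I1 I2) <= 2 * e * (A / nu) + 2 * e * (A / nu)).
{ eapply Rle_trans; [exact (norm_triangle (V := X) I1 (opp I2))|].
  apply Rplus_le_compat; [exact B1|]. eapply Rle_trans; [|exact B2].
  apply Req_le; exact (norm_opp (V := X) I2). }
assert (N1 : norm (opp (scal (RtoC (/ (2 * e)) : C_AbsRing) (minus I1 I2))) <= 2 * A / nu).
{ eapply Rle_trans; [apply Req_le; exact (norm_opp (V := X) _)|].
  eapply Rle_trans; [apply norm_scal_Cmod|].
  rewrite Cmod_R, Rabs_pos_eq by (left; apply Rinv_0_lt_compat; lra).
  eapply Rle_trans; [apply Rmult_le_compat_l; [left; apply Rinv_0_lt_compat; lra|exact N0]|].
  apply Req_le; field; lra. }
assert (N2 : norm (scal (RtoC (/ nu) : C_AbsRing) J') <= norm J' / nu).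
{ eapply Rle_trans; [apply norm_scal_Cmod|].
  rewrite Cmod_R, Rabs_pos_eq by (left; apply Rinv_0_lt_compat; lra).
  apply Req_le; field; lra. }
assert (N3 : norm J <= 2 * A / nu + norm J' / nu).
{ assert (EJ : J = minus (plus J (scal (RtoC (/ nu) : C_AbsRing) J')) (scal (RtoC (/ nu) : C_AbsRing) J')).
  { rewrite (plus_comm J); symmetry; exact (minus_plus_l (G := X) _ _). }
  rewrite EJ at 1.
  eapply Rle_trans; [exact (norm_triangle (V := X) _ (opp _))|].
  apply Rplus_le_compat; [rewrite E; exact N1|].
  eapply Rle_trans; [apply Req_le; exact (norm_opp (V := X) _)|exact N2]. }
pose proof (norm_ge_0 J').
assert (Hi : / nu <= / INR n) by (apply Rinv_le_contravar; lra).
apply Rle_trans with ((2 * A + norm J') * / nu); [unfold Rdiv in N3; lra|].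
apply Rmult_le_compat_l; lra.
Qed.

(** * Factorial estimates and the iterated integration by parts *)

Lemma fact_le_pow (j k : nat) : (j <= k)%nat -> INR (fact j) <= INR k ^ j.
Proof.
induction j as [|j IH]; intros H; [simpl; lra|].
rewrite fact_simpl, mult_INR.
change (INR k ^ S j) with (INR k * INR k ^ j).
apply Rmult_le_compat; try apply pos_INR; [apply le_INR; lia|apply IH; lia].
Qed.

Lemma exp_INR_mult (t : R) (k : nat) : exp t ^ k = exp (INR k * t).
Proof.
induction k as [|k IH]; [simpl; rewrite Rmult_0_l, exp_0; reflexivity|].
rewrite S_INR; simpl; rewrite IH, <- exp_plus; f_equal; ring.
Qed.

(** For k >= 1 the sharper bound with k in place of k + 1 goes through by induction: the step
    amounts to (p / (p + 1))^(p + 1) <= 1/e, which is 1 + s <= exp s at s = -1/(p + 1). The factor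
    [INR k + 1] lets k = 0 be included. *)
Lemma fact_le_Stirling (k : nat) : INR (fact k) <= exp 1 * (INR k + 1) * INR k ^ k * exp (- INR k).
Proof.
assert (K : forall k, INR (fact (S k)) <= exp 1 * INR (S k) * INR (S k) ^ S k * exp (- INR (S k))).
{ clear k; induction k as [|k IH].
  - simpl; rewrite !Rmult_1_r, <- exp_plus, Rplus_opp_r, exp_0; lra.
  - rewrite fact_simpl, mult_INR, (S_INR (S k)).
    set (p := INR (S k)) in *.
    assert (Hp : 0 < p) by (apply lt_0_INR; lia).
    assert (H : p ^ S (S k) <= (p + 1) ^ S (S k) * exp (- 1)).
    { replace (exp (- 1)) with (exp (- / (p + 1)) ^ S (S k)).
      - rewrite <- Rpow_mult_distr; apply pow_incr; split; [lra|].
        apply Rle_trans with ((p + 1) * (1 + - / (p + 1))); [right; field; lra|].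
        apply Rmult_le_compat_l; [lra|apply exp_ineq1_le].
      - rewrite exp_INR_mult, (S_INR (S k)); fold p; f_equal; field; lra. }
    apply Rle_trans with ((p + 1) * (exp 1 * p * p ^ S k * exp (- p))); [apply Rmult_le_compat_l; lra|].
    replace (- (p + 1)) with (-1 + - p) by ring; rewrite exp_plus.
    replace ((p + 1) * (exp 1 * p * p ^ S k * exp (- p))) with (exp 1 * (p + 1) * exp (- p) * p ^ S (S k)) by (simpl; ring).
    replace (exp 1 * (p + 1) * (p + 1) ^ S (S k) * (exp (-1) * exp (- p)))
      with (exp 1 * (p + 1) * exp (- p) * ((p + 1) ^ S (S k) * exp (- 1))) by ring.
    apply Rmult_le_compat_l; [|exact H].
    pose proof (exp_pos 1); pose proof (exp_pos (- p)).
    apply Rmult_le_pos; [apply Rmult_le_pos|]; lra. }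
destruct k as [|k].
- simpl; rewrite Ropp_0, exp_0. pose proof (exp_ineq1_le 1). lra.
- eapply Rle_trans; [apply K|].
  pose proof (exp_pos 1); pose proof (exp_pos (- INR (S k))).
  apply Rmult_le_compat_r; [lra|]. apply Rmult_le_compat_r; [apply pow_le, pos_INR|].
  apply Rmult_le_compat_l; lra.
Qed.

(** Step j contributes D j! (M/n)^(j+1), at most (D/k) (k M/n)^(j+1) by j! <= k^j, hence at most
    D/k; the k steps together cost D. *)
Lemma iterate_step (a : nat -> R) (D M : R) (n k : nat) :
  0 <= D -> 0 < M -> (0 < n)%nat -> INR k * M <= INR n ->
  (forall j, a j <= (D * INR (fact j) * M ^ S j + a (S j)) / INR n) ->
  a O <= D + a k / INR n ^ k.
Proof.
intros HD HM Hn Hk H.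
assert (Hn0 : 0 < INR n) by (apply lt_0_INR; exact Hn).
assert (S0 : forall i, (i <= k)%nat -> a O <= D * (INR i * / INR k) + a i / INR n ^ i).
{ induction i as [|i IH]; intros Hi.
  - simpl; rewrite Rmult_0_l, Rmult_0_r; lra.
  - assert (Hk0 : 0 < INR k) by (apply lt_0_INR; lia).
    specialize (IH ltac:(lia)).
    assert (Pn : 0 < INR n ^ i) by (apply pow_lt; lra).
    assert (H1 : a i / INR n ^ i <= (D * INR (fact i) * M ^ S i + a (S i)) / INR n / INR n ^ i).
    { apply Rmult_le_compat_r; [left; apply Rinv_0_lt_compat; lra|apply H]. }
    assert (H2 : INR (fact i) * M ^ S i / INR n ^ S i <= / INR k).
    { apply Rle_div_l; [apply pow_lt; lra|].
      apply Rle_trans with (INR k ^ i * M ^ S i).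
      - apply Rmult_le_compat_r; [apply pow_le; lra|apply fact_le_pow; lia].
      - apply Rle_trans with (/ INR k * (INR k * M) ^ S i).
        + rewrite Rpow_mult_distr; simpl; right; field; lra.
        + apply Rmult_le_compat_l; [left; apply Rinv_0_lt_compat; lra|].
          apply pow_incr; split; [apply Rmult_le_pos; lra|exact Hk]. }
    replace ((D * INR (fact i) * M ^ S i + a (S i)) / INR n / INR n ^ i)
      with (D * (INR (fact i) * M ^ S i / INR n ^ S i) + a (S i) / INR n ^ S i) in H1
      by (simpl; field; lra).
    assert (D * (INR (fact i) * M ^ S i / INR n ^ S i) <= D * / INR k) by (apply Rmult_le_compat_l; assumption).
    rewrite S_INR; lra. }
eapply Rle_trans; [apply (S0 k), le_n|].
apply Rplus_le_compat_r.
destruct k as [|k]; [simpl; lra|].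
rewrite Rinv_r by (apply not_0_INR; lia); lra.
Qed.

(* Integrating by parts about n / M times makes the remainder of size M exp (- n / M), by Stirling. *)
Lemma high_frequency {X : CompleteNormedModule C_AbsRing} (F : C -> X) (e K M c : R) (n : nat) :
  smooth_punctured_circle F -> 0 < e -> 3 * e <= PI -> (0 < n)%nat -> 0 < K -> 0 < M -> 0 < c < 1 ->
  M * ln (1 + M / e) = c * INR n ->
  (forall j t, e <= Rabs t <= PI ->
     norm (circle_derive_n F j (expi t)) <= K * INR (fact j) * Rabs t * M ^ S j) ->
  norm (wave_integral F e n 0) <= (6 * K + 2 * PI ^ 2 * K * exp 2 / (1 - c)) * e.
Proof.
intros HF He HeP Hn HK HM Hc HMn Hb.
pose proof PI_RGT_0 as HPI.
assert (Hn0 : 0 < INR n) by (apply lt_0_INR; exact Hn).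
set (kap := INR n / M).
assert (Hkap : 0 < kap) by (apply Rdiv_lt_0_compat; assumption).
destruct (nfloor_ex kap) as [k [Hk1 Hk2]]; [lra|].
assert (Ffact : forall j, 0 < INR (fact j)) by (intros; apply lt_0_INR, lt_O_fact).
assert (PM : forall j, 0 < M ^ j) by (intros; apply pow_lt; exact HM).
assert (HkM : INR k * M <= INR n).
{ apply Rle_trans with (kap * M); [apply Rmult_le_compat_r; lra|unfold kap; right; field; lra]. }
(* On the ramps [|t| <= 3 * e], so the two ramp terms cost 2 * 3 = 6 times [K * e]. *)
assert (S1 : norm (wave_integral F e n 0) <= 6 * K * e + norm (wave_integral F e n k) / INR n ^ k).
{ apply (iterate_step (fun j => norm (wave_integral F e n j)) (6 * K * e) M n k); try assumption.
  - apply Rmult_le_pos; lra.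
  - intros j.
    replace (6 * K * e * INR (fact j) * M ^ S j) with (2 * (K * INR (fact j) * (3 * e) * M ^ S j)) by ring.
    assert (P0 : 0 < K * INR (fact j)) by (apply Rmult_lt_0_compat; [exact HK|apply Ffact]).
    apply wave_integral_step; try assumption.
    + apply Rmult_le_pos; [apply Rmult_le_pos; lra|left; apply PM].
    + intros t Ht; eapply Rle_trans; [apply Hb; lra|].
      apply Rmult_le_compat_r; [left; apply PM|]; apply Rmult_le_compat_l; lra. }
(* The crude bound [|t| <= PI] suffices for the last integral: the factor [e] will come from the
   exponential gain in [S3]. *)
assert (S2 : norm (wave_integral F e n k) <= 2 * PI * (K * INR (fact k) * PI * M ^ S k)).
{ assert (P0 : 0 < K * INR (fact k)) by (apply Rmult_lt_0_compat; [exact HK|apply Ffact]).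
  apply wave_integral_bound; try assumption.
  - apply Rmult_le_pos; [apply Rmult_le_pos; lra|left; apply PM].
  - intros t Ht; eapply Rle_trans; [apply Hb; exact Ht|].
    apply Rmult_le_compat_r; [left; apply PM|]; apply Rmult_le_compat_l; lra. }
assert (Pn : 0 < INR n ^ k) by (apply pow_lt; exact Hn0).
assert (S3 : INR (fact k) * M ^ S k / INR n ^ k <= exp 2 / (1 - c) * e).
{ replace (INR n) with (kap * M) by (unfold kap; field; lra).
  rewrite Rpow_mult_distr.
  replace (INR (fact k) * M ^ S k / (kap ^ k * M ^ k)) with (M * (INR (fact k) / kap ^ k))
    by (simpl; field; split; [apply Rgt_not_eq, PM|apply pow_nonzero; lra]).
  (* Since k <= kap < k + 1, replacing k by kap in the Stirling bound loses only one factor e in the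
     exponential; with the factor [exp 1] already there this gives [exp 2]. *)
  assert (T1 : INR (fact k) / kap ^ k <= exp 2 * (kap + 1) * exp (- kap)).
  { apply Rle_div_l; [apply pow_lt; exact Hkap|].
    eapply Rle_trans; [apply fact_le_Stirling|].
    replace (exp 1 * (INR k + 1) * INR k ^ k * exp (- INR k))
      with ((exp 1 * (INR k + 1) * exp (- INR k)) * INR k ^ k) by ring.
    pose proof (pos_INR k). pose proof (exp_pos 1). pose proof (exp_pos (- INR k)).
    apply Rmult_le_compat.
    - apply Rmult_le_pos; [apply Rmult_le_pos|]; lra.
    - apply pow_le; lra.
    - replace (exp 2 * (kap + 1) * exp (- kap)) with (exp 1 * (kap + 1) * exp (1 + - kap)).
      + apply Rmult_le_compat; [apply Rmult_le_pos; lra|lra|apply Rmult_le_compat_l; lra|].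
        left; apply exp_increasing; lra.
      + rewrite exp_plus; replace 2 with (1 + 1) by ring; rewrite exp_plus; ring.
    - apply pow_incr; lra. }
  (* The defining equation of [e] enters here: ln (1 + M/e) = c n/M, so e + M equals e exp (c
     kap). *)
  assert (T2 : M <= e * exp (c * kap)).
  { replace (c * kap) with (ln (1 + M / e)) by (unfold kap, Rdiv; rewrite <- Rmult_assoc, <- HMn; unfold Rdiv; field; lra).
    assert (0 < M / e) by (apply Rdiv_lt_0_compat; assumption).
    rewrite exp_ln by lra. replace (e * (1 + M / e)) with (e + M) by (field; lra). lra. }
  (* The exponential surplus left by c < 1 absorbs the polynomial factor kap + 1, at the price of
     1/(1 - c). *)
  assert (T3 : (1 - c) * (kap + 1) <= exp ((1 - c) * kap)).
  { pose proof (exp_ineq1_le ((1 - c) * kap)). nra. }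
  assert (T4 : exp (c * kap) * exp (- kap) * exp ((1 - c) * kap) = 1).
  { rewrite <- !exp_plus; replace (c * kap + - kap + (1 - c) * kap) with 0 by ring; exact exp_0. }
  pose proof (exp_pos 2); pose proof (exp_pos (- kap)); pose proof (exp_pos (c * kap)).
  apply Rle_trans with ((e * exp (c * kap)) * (exp 2 * (kap + 1) * exp (- kap))).
  - apply Rmult_le_compat; [lra| |exact T2|exact T1].
    left; apply Rdiv_lt_0_compat; [apply Ffact|apply pow_lt; exact Hkap].
  - replace (exp 2 / (1 - c) * e) with (exp 2 * e * exp (c * kap) * exp (- kap) * (exp ((1 - c) * kap) / (1 - c))).
    + replace (e * exp (c * kap) * (exp 2 * (kap + 1) * exp (- kap)))
        with (exp 2 * e * exp (c * kap) * exp (- kap) * (kap + 1)) by ring.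
      apply Rmult_le_compat_l; [repeat apply Rmult_le_pos; lra|].
      apply Rle_div_r; [lra|]. lra.
    + transitivity (exp 2 / (1 - c) * e * (exp (c * kap) * exp (- kap) * exp ((1 - c) * kap)));
        [field; lra|rewrite T4; ring]. }
assert (S4 : norm (wave_integral F e n k) / INR n ^ k <= 2 * PI ^ 2 * K * (exp 2 / (1 - c) * e)).
{ apply Rle_trans with (2 * PI ^ 2 * K * (INR (fact k) * M ^ S k / INR n ^ k)).
  - apply Rle_div_l; [exact Pn|]. eapply Rle_trans; [exact S2|]; right; field; lra.
  - apply Rmult_le_compat_l; [|exact S3].
    apply Rmult_le_pos; [|lra]. apply Rmult_le_pos; [lra|apply pow_le; lra]. }
eapply Rle_trans; [exact S1|].
replace ((6 * K + 2 * PI ^ 2 * K * exp 2 / (1 - c)) * e)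
  with (6 * K * e + 2 * PI ^ 2 * K * (exp 2 / (1 - c) * e)) by (field; lra).
lra.
Qed.

(** * The inverse of mlog *)

(** As [m] may be constant on intervals, strictness comes from the logarithm: m(eps)/eps decreases
    strictly in any case. *)
Lemma mlog_decreasing (m : R -> R) (a b : R) :
  (forall e, 0 < e <= PI -> 0 < m e) ->
  (forall e1 e2, 0 < e1 -> e1 <= e2 -> e2 <= PI -> m e2 <= m e1) ->
  0 < a -> a < b -> b <= PI -> mlog m b < mlog m a.
Proof.
intros Hpos Hdec Ha Hab Hb; unfold mlog.
assert (Hma : 0 < m a) by (apply Hpos; lra).
assert (Hmb : 0 < m b) by (apply Hpos; lra).
assert (Hm : m b <= m a) by (apply Hdec; lra).
assert (Q : m b / b < m a / a).
{ apply Rlt_le_trans with (m b / a).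
  - apply Rmult_lt_compat_l; [exact Hmb|apply Rinv_lt_contravar; nra].
  - apply Rmult_le_compat_r; [left; apply Rinv_0_lt_compat; lra|exact Hm]. }
assert (0 < m b / b) by (apply Rdiv_lt_0_compat; lra).
assert (0 < ln (1 + m b / b)) by (rewrite <- ln_1; apply ln_increasing; lra).
assert (ln (1 + m b / b) < ln (1 + m a / a)) by (apply ln_increasing; lra).
apply Rle_lt_trans with (m a * ln (1 + m b / b)).
- apply Rmult_le_compat_r; lra.
- apply Rmult_lt_compat_l; lra.
Qed.

Lemma mlog_surjective (m : R -> R) (t : R) :
  (forall e, 0 < e <= PI -> 0 < m e) ->
  continuous_on (fun e => 0 < e <= PI) m ->
  (forall e1 e2, 0 < e1 -> e1 <= e2 -> e2 <= PI -> m e2 <= m e1) ->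
  mlog m PI <= t -> exists e, 0 < e <= PI /\ mlog m e = t.
Proof.
intros Hpos Hcont Hdec Ht.
pose proof PI_RGT_0 as HPI.
assert (HmP : 0 < m PI) by (apply Hpos; lra).
(* [m] may stay bounded near 0, so the growth is taken from the logarithm: this [d] gives ln (m PI /
   d) >= t / m PI, hence [mlog m d >= t]. *)
set (d := Rmin PI (m PI / exp (t / m PI))).
assert (Hd : 0 < d <= PI).
{ unfold d; split; [|apply Rmin_l].
  apply Rmin_glb_lt; [lra|apply Rdiv_lt_0_compat; [exact HmP|apply exp_pos]]. }
assert (Hmd : m PI <= m d) by (apply Hdec; lra).
assert (Htd : t <= mlog m d).
{ unfold mlog.
  assert (E : exp (t / m PI) <= m PI / d).
  { apply Rle_div_r; [lra|].
    apply Rle_trans with (exp (t / m PI) * (m PI / exp (t / m PI))).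
    - apply Rmult_le_compat_l; [left; apply exp_pos|apply Rmin_r].
    - right; field; apply Rgt_not_eq, exp_pos. }
  assert (m PI / d <= m d / d) by (apply Rmult_le_compat_r; [left; apply Rinv_0_lt_compat; lra|exact Hmd]).
  pose proof (exp_pos (t / m PI)).
  assert (L : t / m PI <= ln (1 + m d / d)).
  { rewrite <- (ln_exp (t / m PI)) at 1; apply ln_le; lra. }
  assert (0 <= ln (1 + m d / d)) by (rewrite <- ln_1; apply ln_le; lra).
  apply Rle_trans with (m PI * ln (1 + m d / d)); [|apply Rmult_le_compat_r; assumption].
  apply Rle_trans with (m PI * (t / m PI)); [right; field; lra|].
  apply Rmult_le_compat_l; lra. }
(* m is extended beyond [d, PI] by constants, since IVT_gen wants a function continuous on R *)
set (cl := fun e => Rmax d (Rmin e PI)).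
assert (Hcl : forall e, d <= cl e <= PI).
{ intros e; unfold cl; split; [apply Rmax_l|apply Rmax_lub; [lra|apply Rmin_r]]. }
assert (Hid : forall e, d <= e <= PI -> cl e = e).
{ intros e He; unfold cl; rewrite Rmin_left, Rmax_right by lra; reflexivity. }
assert (Ccl : forall e, continuous cl e).
{ intros e P [r Hr]; exists r; intros y Hy; apply Hr.
  change (Rabs (y - e) < r) in Hy; change (Rabs (cl y - cl e) < r).
  eapply Rle_lt_trans; [|exact Hy]; unfold cl, Rmax, Rmin.
  repeat destruct (Rle_dec _ _); unfold Rabs; repeat destruct (Rcase_abs _); lra. }
assert (Cm : forall e, continuous (fun e => m (cl e)) e).
{ intros e.
  apply (filterlim_comp _ _ _ cl m (locally e) (within (fun e => 0 < e <= PI) (locally (cl e)))).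
  - intros P HP; unfold filtermap; assert (Hloc := Ccl e _ HP); unfold filtermap in Hloc.
    revert Hloc; apply filter_imp; intros y Hy; apply Hy; specialize (Hcl y); lra.
  - apply Hcont; specialize (Hcl e); lra. }
assert (Cf : continuity (fun e => mlog m (cl e))).
{ intros e; apply continuity_pt_filterlim.
  specialize (Hcl e).
  assert (0 < m (cl e)) by (apply Hpos; lra).
  assert (0 < m (cl e) / cl e) by (apply Rdiv_lt_0_compat; lra).
  unfold mlog.
  apply (continuous_mult (K := R_AbsRing) (fun e => m (cl e)) (fun e => ln (1 + m (cl e) / cl e))).
  - apply Cm.
  - apply (continuous_comp (fun e => 1 + m (cl e) / cl e) ln).
    + apply (continuous_plus (V := R_NormedModule) (fun _ => 1) (fun e => m (cl e) / cl e));
        [apply continuous_const|].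
      apply (continuous_mult (K := R_AbsRing) (fun e => m (cl e)) (fun e => / cl e)); [apply Cm|].
      apply (continuous_comp cl Rinv); [apply Ccl|apply continuous_Rinv; lra].
    + apply (ex_derive_continuous (K := R_AbsRing) (V := R_NormedModule)); auto_derive; lra. }
destruct (IVT_gen (fun e => mlog m (cl e)) d PI t Cf) as [e [He Ee]].
- rewrite !Hid by lra; split.
  + eapply Rle_trans; [apply Rmin_r|exact Ht].
  + eapply Rle_trans; [exact Htd|apply Rmax_l].
- rewrite Rmin_left, Rmax_right in He by lra.
  exists e; split; [lra|rewrite <- Ee, Hid by lra; reflexivity].
Qed.

Lemma mlog_inv_spec (m : R -> R) (t : R) :
  (forall e, 0 < e <= PI -> 0 < m e) ->
  continuous_on (fun e => 0 < e <= PI) m ->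
  (forall e1 e2, 0 < e1 -> e1 <= e2 -> e2 <= PI -> m e2 <= m e1) ->
  mlog m PI <= t -> 0 < mlog_inv m t <= PI /\ mlog m (mlog_inv m t) = t.
Proof.
intros Hpos Hcont Hdec Ht; unfold mlog_inv.
apply (iota_correct (V := R_CompleteNormedModule) (fun e : R => 0 < e <= PI /\ mlog m e = t)).
destruct (mlog_surjective m t Hpos Hcont Hdec Ht) as [e [He Ee]].
exists e; split; [split; assumption|].
intros e' [He' Ee'].
destruct (Rtotal_order e e') as [L|[L|L]]; [|exact L|].
- pose proof (mlog_decreasing m e e' Hpos Hdec ltac:(lra) L ltac:(lra)); lra.
- pose proof (mlog_decreasing m e' e Hpos Hdec ltac:(lra) L ltac:(lra)); lra.
Qed.

(** * Decay of the coefficients *)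

Lemma continuous_test_function (e : R) (n : nat) (t : R) : 0 < e ->
  continuous (T := R_UniformSpace) (U := C_UniformSpace) (test_function e n) t.
Proof.
intros He; pose proof (continuous_cutoff e t He) as Hc.
assert (D : forall f : R -> R, (forall u, ex_derive f u) -> continuous (fun u => cutoff e u * f u) t).
{ intros f Hf; apply (continuous_mult (K := R_AbsRing) (cutoff e) f); [exact Hc|].
  apply (ex_derive_continuous (K := R_AbsRing) (V := R_NormedModule)), Hf. }
apply (continuous_ext (fun u => (cutoff e u * cos (INR (S n) * u), cutoff e u * sin (INR (S n) * u)))).
{ intros u; unfold test_function, expi, Cmult, RtoC; cbn [fst snd]; f_equal; ring. }
refine (continuous_comp_2 (U := R_UniformSpace) (V := R_UniformSpace) (W := R_UniformSpace)
  (X := C_UniformSpace) _ _ pair t _ _ _).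
- apply (D (fun u => cos (INR (S n) * u))); intros u; auto_derive; trivial.
- apply (D (fun u => sin (INR (S n) * u))); intros u; auto_derive; trivial.
- intros P HP; refine (filter_imp P _ _ HP); intros [u v] h; exact h.
Qed.

(** For each r > 1, [low_frequency] and the triangle inequality bound [x n] by r^(n+1)/(2 PI) times
    [216 * e * B + norm (T r)]. As r decreases to 1, [T r] tends to the integral with [F]; finally
    1/(2 PI) <= 1. *)
Lemma coefficient_bound {X : CompleteNormedModule C_AbsRing} (x : nat -> X) (F : C -> X) (D B e : R) (n : nat) :
  0 < e -> 3 * e <= PI -> 0 <= B ->
  (forall k, norm (x k) <= D) -> (forall k, norm (sum_n x k) <= B) ->
  is_boundary_function (Gseries x) F ->
  norm (x n) <= 216 * e * B + norm (wave_integral F e n 0).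
Proof.
intros He HeP HB HD Hs [_ HF].
pose proof PI_RGT_0 as HPI.
assert (L := HF (test_function e n)).
set (T := fun r => RInt (V := real_space X) (fun t => scal (test_function e n t : C_AbsRing)
       (Gseries x (Cmult (RtoC r) (expi t)))) (- PI) PI : X).
assert (L' : filterlim T (at_right 1) (locally (wave_integral F e n 0))).
{ refine (eq_rect _ (fun l => filterlim T (at_right 1) (locally l)) (L _ _) _ _).
  - intros t _; eapply filterlim_filter_le_1; [apply filter_le_within|].
    apply continuous_test_function; exact He.
  (* The test function vanishes for [|s| <= e], so radius [e] witnesses that 0 lies outside its
     closed support. *)
  - intros Hsup; destruct (Hsup (mkposreal e He)) as [s [_ [Hse Hne]]]; apply Hne.
    rewrite Rminus_0_r in Hse; simpl in Hse.
    unfold test_function; rewrite cutoff_near by lra; apply Cmult_0_l.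
  - apply (RInt_ext (V := real_space X)); intros t _.
    unfold test_function, wave; rewrite scal_Cmult, Nat.add_0_r; reflexivity. }
assert (L1 : filterlim (fun r => norm (T r)) (at_right 1) (locally (norm (wave_integral F e n 0)))).
{ exact (filterlim_comp _ _ _ T norm _ _ _ L' (filterlim_norm (V := X) _)). }
assert (L2 : filterlim (fun r => / (2 * PI) * r ^ S n * (216 * e * B + norm (T r))) (at_right 1)
   (locally (/ (2 * PI) * 1 ^ S n * (216 * e * B + norm (wave_integral F e n 0))))).
{ apply (filterlim_comp_2 (G := locally (/ (2 * PI) * 1 ^ S n))
    (H := locally (216 * e * B + norm (wave_integral F e n 0)))).
  - apply (filterlim_filter_le_1 (F := locally 1) (G := at_right 1) _ (filter_le_within _)).
    apply (ex_derive_continuous (K := R_AbsRing) (V := R_NormedModule) (fun r => / (2 * PI) * r ^ S n)).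
    auto_derive; trivial.
  - apply (filterlim_comp_2 (G := locally (216 * e * B)) (H := locally (norm (wave_integral F e n 0))));
      [apply filterlim_const|exact L1|apply (filterlim_plus (V := R_NormedModule))].
  - apply (filterlim_mult (K := R_AbsRing)). }
assert (H : norm (x n) <= / (2 * PI) * 1 ^ S n * (216 * e * B + norm (wave_integral F e n 0))).
{ refine (filterlim_le (F := at_right 1) (fun _ => norm (x n)) _ (Finite (norm (x n)))
    (Finite (/ (2 * PI) * 1 ^ S n * (216 * e * B + norm (wave_integral F e n 0)))) _ _ L2);
    [|apply filterlim_const].
  exists (mkposreal 1 Rlt_0_1); intros r _ Hr.
  assert (Hl := low_frequency x D B e r n He HeP Hr HB HD Hs); fold (T r) in Hl.
  change (norm (minus (T r) (scal (RtoC (2 * PI * (/ r) ^ S n) : C_AbsRing) (x n))) <= 216 * e * B) in Hl.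
  set (y := scal (RtoC (2 * PI * (/ r) ^ S n) : C_AbsRing) (x n)) in *.
  assert (Hr0 : 0 < r ^ S n) by (apply pow_lt; lra).
  assert (P : 0 < / (2 * PI) * r ^ S n).
  { apply Rmult_lt_0_compat; [apply Rinv_0_lt_compat; lra|exact Hr0]. }
  assert (Ey : x n = scal (RtoC (/ (2 * PI) * r ^ S n) : C_AbsRing) y).
  { unfold y; rewrite <- scal_Cmult, <- RtoC_mult, pow_inv.
    replace (/ (2 * PI) * r ^ S n * (2 * PI * / r ^ S n)) with 1 by (field; lra).
    symmetry; exact (scal_one (x n)). }
  rewrite Ey; eapply Rle_trans; [apply norm_scal_Cmod|].
  rewrite Cmod_R, Rabs_pos_eq by lra.
  apply Rmult_le_compat_l; [lra|].
  assert (Tr := norm_triangle_inv (V := X) y (T r)).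
  pose proof (Rle_abs (norm y - norm (T r))).
  assert (norm (minus y (T r)) = norm (minus (T r) y)).
  { rewrite <- (norm_opp (V := X)); f_equal; exact (opp_minus (G := X) _ _). }
  change (norm y - norm (T r) <= Rabs (norm y - norm (T r))) in H.
  change (Rabs (norm y - norm (T r)) <= norm (minus y (T r))) in Tr.
  lra. }
eapply Rle_trans; [exact H|].
assert (0 <= 216 * e * B + norm (wave_integral F e n 0)).
{ pose proof (norm_ge_0 (wave_integral F e n 0)); assert (0 <= e * B) by (apply Rmult_le_pos; lra); lra. }
assert (/ (2 * PI) <= 1).
{ rewrite <- Rinv_1; apply Rinv_le_contravar; [lra|]. pose proof PI2_3_2; unfold PI2 in *; lra. }
rewrite pow1, Rmult_1_r.
rewrite <- (Rmult_1_l (216 * e * B + _)) at 2; apply Rmult_le_compat_r; assumption.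
Qed.

Theorem theorem2p4 :
  forall (X : CompleteNormedModule C_AbsRing) (x : nat -> X) (F : C -> X) (m : R -> R),
    bounded_seq x ->
    bounded_seq (sum_n x) ->
    is_boundary_function (Gseries x) F ->
    smooth_punctured_circle F ->
    (forall eps : R, 0 < eps <= PI -> 0 < m eps) ->
    continuous_on (fun eps : R => 0 < eps <= PI) m ->
    (forall eps1 eps2 : R, 0 < eps1 -> eps1 <= eps2 -> eps2 <= PI -> m eps2 <= m eps1) ->
    (exists K : R, 0 < K /\
       forall (j : nat) (theta : R), 0 < Rabs theta <= PI ->
         norm (circle_derive_n F j (expi theta))
           <= K * INR (fact j) * Rabs theta * m (Rabs theta) ^ (j + 1)) ->
    forall c : R, 0 < c < 1 ->
      exists (M : R) (N : nat), forall n : nat, (N <= n)%nat ->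
        norm (x n) <= M * mlog_inv m (c * INR n).
Proof.
intros X x F m [D HD] [B HB] HF Hsm Hpos Hcont Hdec [K [HK Hder]] c Hc.
pose proof PI_RGT_0 as HPI.
exists (216 * B + (6 * K + 2 * PI ^ 2 * K * exp 2 / (1 - c))).
assert (HB0 : 0 <= B) by (exact (Rle_trans _ _ _ (norm_ge_0 (sum_n x O)) (HB O))).
(* Beyond this threshold c n exceeds [mlog m (PI / 3)], so monotonicity forces e <= PI/3 and the
   ramps fit into the period. [Rmax 0] provides the nonnegative argument of [nfloor_ex]. *)
destruct (nfloor_ex (Rmax 0 (mlog m (PI / 3)) / c)) as [N [_ HN]].
{ apply Rdiv_le_0_compat; [apply Rmax_l|lra]. }
exists (S N); intros n Hn.
assert (Hn1 : Rmax 0 (mlog m (PI / 3)) < c * INR n).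
{ assert (HSN : INR N + 1 <= INR n) by (rewrite <- S_INR; apply le_INR; exact Hn).
  apply Rlt_div_l in HN; [|lra]. nra. }
assert (Hn2 : mlog m (PI / 3) < c * INR n) by (eapply Rle_lt_trans; [apply Rmax_r|exact Hn1]).
assert (Hn3 : mlog m PI <= c * INR n).
{ pose proof (mlog_decreasing m (PI / 3) PI Hpos Hdec ltac:(lra) ltac:(lra) ltac:(lra)); lra. }
destruct (mlog_inv_spec m (c * INR n) Hpos Hcont Hdec Hn3) as [He Ee].
set (e := mlog_inv m (c * INR n)) in *.
assert (He3 : 3 * e <= PI).
{ destruct (Rle_dec e (PI / 3)) as [L|L]; [lra|].
  pose proof (mlog_decreasing m (PI / 3) e Hpos Hdec ltac:(lra) ltac:(lra) ltac:(lra)); lra. }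
assert (Hhigh : norm (wave_integral F e n 0) <= (6 * K + 2 * PI ^ 2 * K * exp 2 / (1 - c)) * e).
{ apply (high_frequency F e K (m e)); try assumption; try lra; try lia.
  - apply Hpos; exact He.
  - intros j t Ht; eapply Rle_trans; [apply Hder; lra|].
    rewrite Nat.add_1_r.
    assert (0 < INR (fact j)) by apply lt_0_INR, lt_O_fact.
    apply Rmult_le_compat_l.
    + apply Rmult_le_pos; [apply Rmult_le_pos|]; lra.
    (* Monotonicity replaces the varying [m |t|] by the single constant [M = m e] on all of
       [|t| >= e]. *)
    + apply pow_incr; split; [left; apply Hpos; lra|apply Hdec; lra]. }
assert (Hx := coefficient_bound x F D B e n ltac:(lra) He3 HB0 HD HB HF).
lra.
Qed.
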